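(* Let $\Gamma$ be the unit circle in $\mathbb{C}$ and let $(M_n)$ be a non-analytic weight sequence. If $\phi$ is an analytic self-map of $\Gamma$ with $\|\phi'\|_\infty<1$, then $\phi$ induces a compact endomorphism of $D(\Gamma,M)$. Further, if any self-map $\phi$ of $\Gamma$ (not assumed analytic) induces a compact endomorphism of $D(\Gamma,M)$, then necessarily $\|\phi'\|_\infty<1$.
   Context: For a perfect compact plane set $X$, $f:X\to\mathbb{C}$ is complex-differentiable at $a\in X$ if $f'(a)=\lim_{z\to a,\ z\in X}\frac{f(z)-f(a)}{z-a}$ exists; $f^{(n)}$ denotes the $n$-th complex derivative in this sense (with $f^{(0)}=f$), and $D^\infty(X)$ is the set of infinitely complex-differentiable functions on $X$. A weight sequence is a sequence $(M_n)_{n\ge 0}$ of positive numbers with $M_0=1$ and $\frac{M_{n+m}}{M_nM_m}\ge\binom{n+m}{n}$ for all non-negative integers $m,n$; it is non-analytic if $\lim_{n\to\infty}(n!/M_n)^{1/n}=0$. The Dales-Davie algebra is $$D(X,M)=\Big\{f\in D^\infty(X):\ \|f\|_D=\sum_{n=0}^\infty\frac{\|f^{(n)}\|_\infty}{M_n}<\infty\Big\},$$ where $\|\cdot\|_\infty$ is the supremum norm on $X$. A map $\phi\in D^\infty(X)$ is called analytic if $\sup_{k\ge1}\left(\|\phi^{(k)}\|_\infty/k!\right)^{1/k}<\infty$; an analytic self-map of $X$ is an analytic $\phi$ with $\phi(X)\subseteq X$. A self-map $\phi$ of $X$ induces an endomorphism of $D(X,M)$ if $f\circ\phi\in D(X,M)$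 for every $f\in D(X,M)$ (then in particular $\phi\in D(X,M)$, so $\phi'$ exists on $X$); the induced endomorphism is $f\mapsto f\circ\phi$, and it is called compact if it is a compact linear operator. *)

(* Defs.v *)
From HB Require Import structures.
From mathcomp Require Import all_boot all_order all_algebra.
From mathcomp Require Import all_classical all_reals all_analysis.
From mathcomp Require Import complex.

Set Implicit Arguments.
Unset Strict Implicit.
Unset Printing Implicit Defensive.

Import Order.TTheory GRing.Theory Num.Theory.
Import numFieldNormedType.Exports.

Local Open Scope classical_set_scope.
Local Open Scope ring_scope.
Local Open Scope complex_scope.

(* The usual topology of the complex plane: the one that every numFieldType
   carries through its norm, made available on R[i]. *)
HB.instance Definition _ (R : realType) :=
  NormedModule.copy R[i] (R[i] : numFieldType).

Section DalesDavie.
Variable R : realType.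
Implicit Types (X : set R[i]) (f g phi : R[i] -> R[i]) (M : nat -> R).

(* A function on X is represented by a total function on R[i]; every notion
   below only depends on its values on X. *)

Definition diff_quotient f (a z : R[i]) : R[i] := (f z - f a) / (z - a).

Definition cdifferentiable X f (a : R[i]) : Prop :=
  cvg (diff_quotient f a z @[z --> within X a^']).

(* When X is perfect, a is in X and f is complex-differentiable at a, this is
   the unique limit of the difference quotient; otherwise it is unspecified. *)
Definition cderiv X f (a : R[i]) : R[i] :=
  lim (diff_quotient f a z @[z --> within X a^']).

Definition cderivn X (n : nat) f : R[i] -> R[i] := iter n (cderiv X) f.

Definition D_infty X : set (R[i] -> R[i]) :=
  [set f | forall n a, X a -> cdifferentiable X (cderivn X n f) a].

(* normc is the modulus with values in R, whereas `|z| lives in R[i]. *)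
Definition supnorm X f : \bar R :=
  ereal_sup [set (ComplexField.Normc.normc (f z))%:E | z in X].

Definition weight_sequence M : Prop :=
  [/\ forall n, 0 < M n,
      M 0%N = 1
    & forall m n, 'C(n + m, n)%:R <= M (n + m)%N / (M n * M m)].

Definition nonanalytic M : Prop :=
  (n`!%:R / M n) `^ (n%:R^-1) @[n --> \oo] --> (0 : R).

Definition D_norm X M f : \bar R :=
  (\sum_(0 <= n <oo) supnorm X (cderivn X n f) * ((M n)^-1)%:E)%E.

Definition dales_davie X M : set (R[i] -> R[i]) :=
  [set f | D_infty X f /\ (D_norm X M f < +oo)%E].

Definition analytic X phi : Prop :=
  D_infty X phi /\
  (ereal_sup [set (supnorm X (cderivn X k phi) * (k`!%:R^-1)%:E) `^ (k%:R^-1)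
             | k in [set k : nat | (1 <= k)%N]] < +oo)%E.

Definition self_map X phi : Prop := phi @` X `<=` X.

Definition induces_endomorphism X M phi : Prop :=
  forall f, dales_davie X M f -> dales_davie X M (f \o phi).

(* Compactness of an operator T on D(X, M): T maps every bounded sequence to a
   sequence that has a subsequence converging in D(X, M). *)
Definition compact_operator X M (T : (R[i] -> R[i]) -> (R[i] -> R[i])) : Prop :=
  forall (F : nat -> R[i] -> R[i]) (B : R),
    (forall n, dales_davie X M (F n)) ->
    (forall n, (D_norm X M (F n) <= B%:E)%E) ->
    exists s : nat -> nat, {homo s : m n / (m < n)%N} /\
      exists2 g, dales_davie X M g &
        D_norm X M (T (F (s n)) \- g) @[n --> \oo] --> (0 : \bar R)%E.

Definition induces_compact_endomorphism X M phi : Prop :=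
  induces_endomorphism X M phi /\ compact_operator X M (fun f => f \o phi).

Definition unit_circle : set R[i] := [set z | `|z| = 1].

End DalesDavie.

Arguments unit_circle : clear implicits.

(* Main.v *)
Require Import Defs.
From mathcomp Require Import all_boot all_order all_algebra.
From mathcomp Require Import all_classical all_reals all_analysis.
From mathcomp Require Import complex.
From mathcomp Require Import ring lra zify.

(** Sufficiency. By the formula of Faa di Bruno, (f o phi)^(n) is a combination of
    the f^(m) o phi with m <= n, whose coefficients are controlled by the powers
    p^m of the power series p(t) = sum_(k >= 1) ||phi^(k)|| t^k / k!. The weight
    inequality for M and the fact that k! / M_k is dominated by every geometric
    sequence turn this into
      ||f o phi||_D <= sum_m A rho^m ||f^(m)|| / M_m   with   rho < 1,
    because p(e) / e is close to ||phi'|| < 1 for small e ([composition_bound]).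
    Hence f o phi belongs to D, and high derivatives of f contribute little. In a
    bounded sequence of D all derivatives are equicontinuous, so along an
    ultrafilter they converge uniformly, to the derivatives of a function of D
    ([circle_montel]); the convergence of finitely many derivatives is enough for
    the images under composition to converge in norm ([compact_sufficient]).

    Necessity. Suppose that |phi'(a)| >= 1 at some a, and put b = phi(a). On the
    space V_n of functions that vanish to order n at b, composition with phi acts
    on the first nonzero derivative as multiplication by phi'(a)^n
    ([cderivn_comp_lead]). A compact operator cannot have infinitely many
    eigenvalues, counted with multiplicity, of modulus at least 1. The direct
    argument is that of Riesz: take f_n in the unit ball of V_n with f_n^(n)(b)
    almost as large as possible. The images of the f_n stay at distance at least
    1/2 from each other, because the circle is homogeneous: rotations preserve
    the norm, so that extremality at b can be used at a ([extremal_transport],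
    [compact_necessary]). *)

Set Implicit Arguments.
Unset Strict Implicit.
Unset Printing Implicit Defensive.

Import Order.TTheory GRing.Theory Num.Theory.
Import numFieldNormedType.Exports.

Local Open Scope classical_set_scope.
Local Open Scope ring_scope.
Local Open Scope complex_scope.

Local Notation nrm z := (ComplexField.Normc.normc z).

(** * The modulus of a complex number *)

Section Modulus.
Variable R : realType.
Implicit Types (x y z : R[i]) (t : R).

Lemma normE z : `|z| = (nrm z)%:C.
Proof. by case: z. Qed.

Lemma nrmM x y : nrm (x * y) = nrm x * nrm y.
Proof. exact: ComplexField.Normc.normcM. Qed.

Lemma nrmV x : nrm x^-1 = (nrm x)^-1.
Proof. exact: ComplexField.Normc.normcV. Qed.

Lemma nrmN x : nrm (- x) = nrm x.
Proof. exact: normcN. Qed.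

Lemma nrm0 : nrm (0 : R[i]) = 0.
Proof. exact: ComplexField.Normc.normc0. Qed.

Lemma nrm1 : nrm (1 : R[i]) = 1.
Proof. exact: ComplexField.Normc.normc1. Qed.

Lemma nrmB x y : nrm (x - y) = nrm (y - x).
Proof. by rewrite -nrmN opprB. Qed.

Lemma nrm_ge0 z : 0 <= nrm z.
Proof. by case: z => a b; exact: sqrtr_ge0. Qed.

Lemma nrmD x y : nrm (x + y) <= nrm x + nrm y.
Proof. exact: le_normcD. Qed.

Lemma nrm_eq0 z : (nrm z == 0) = (z == 0).
Proof.
apply/eqP/eqP => [|->]; last exact: nrm0.
exact: ComplexField.Normc.eq0_normc.
Qed.

Lemma nrm_gt0 z : (0 < nrm z) = (z != 0).
Proof. by rewrite lt_neqAle nrm_ge0 andbT eq_sym nrm_eq0. Qed.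

Lemma nrmX z n : nrm (z ^+ n) = nrm z ^+ n.
Proof. by elim: n => [|n IH]; rewrite ?expr0 ?nrm1 // !exprS nrmM IH. Qed.

Lemma nrm_real t : nrm t%:C = `|t|.
Proof. by rewrite /= expr0n /= addr0 sqrtr_sqr. Qed.

Lemma nrm_nat n : nrm (n%:R : R[i]) = n%:R.
Proof.
by rewrite (_ : n%:R = (n%:R)%:C) ?nrm_real ?ger0_norm // rmorph_nat.
Qed.

Lemma nrm_sum n (F : nat -> R[i]) :
  nrm (\sum_(k < n) F k) <= \sum_(k < n) nrm (F k).
Proof.
elim: n => [|n IH]; first by rewrite !big_ord0 nrm0.
by rewrite !big_ord_recr /= (le_trans (nrmD _ _)) // lerD2r.
Qed.

Lemma sqr_nrm z : nrm z ^+ 2 = complex.Re z ^+ 2 + complex.Im z ^+ 2.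
Proof. by case: z => a b /=; rewrite sqr_sqrtr // addr_ge0 // sqr_ge0. Qed.

Lemma Re_le_nrm z : `|complex.Re z| <= nrm z.
Proof.
rewrite -(ler_pXn2r (n := 2)) ?nnegrE ?nrm_ge0 // sqr_nrm real_normK ?num_real //.
by rewrite lerDl sqr_ge0.
Qed.

Lemma Im_le_nrm z : `|complex.Im z| <= nrm z.
Proof.
rewrite -(ler_pXn2r (n := 2)) ?nnegrE ?nrm_ge0 // sqr_nrm real_normK ?num_real //.
by rewrite lerDr sqr_ge0.
Qed.

Lemma nrm_le_ReIm z : nrm z <= `|complex.Re z| + `|complex.Im z|.
Proof.
rewrite -(ler_pXn2r (n := 2)) ?nnegrE ?nrm_ge0 ?addr_ge0 // sqr_nrm sqrrD.
by rewrite !real_normK ?num_real // lerD2r lerDl mulrn_wge0 // mulr_ge0.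
Qed.

Lemma unit_circleE z : unit_circle R z <-> nrm z = 1.
Proof.
rewrite /unit_circle /= normE; split=> [[]//|->//].
Qed.

End Modulus.

(** * Complex derivatives along a subset of the plane *)

Section Derivative.
Variable R : realType.
Implicit Types (X Y : set R[i]) (f g : R[i] -> R[i]) (a b l m z : R[i]).

(** Differentiability in first-order form, with a real error bound: no division
    and no limit, so that the chain rule goes through even where the inner
    function takes the value at the base point infinitely often. *)
Definition has_cderiv X f a l : Prop :=
  forall e : R, 0 < e -> exists2 d : R, 0 < d & forall z, X z ->
    nrm (z - a) < d -> nrm (f z - f a - l * (z - a)) <= e * nrm (z - a).

Lemma near_withinE X a (P : R[i] -> Prop) :
  (\forall z \near within X a^', P z) <->
  exists2 d : R, 0 < d & forall z, X z -> z != a -> nrm (z - a) < d -> P z.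
Proof.
rewrite /= !near_withinE; split.
  move=> /nbhs_ballP[[d d'] /= d0 H]; move: d0; rewrite ltcE /= => /andP[/eqP d'0 d0].
  subst d'; exists d => // z Xz za zd; apply: H => //.
  by rewrite -ball_normE /= normE ltcR nrmB.
case=> d d0 H; apply/nbhs_ballP; exists d%:C; first by rewrite /= ltcR.
move=> z; rewrite -ball_normE /= normE ltcR nrmB => zd za Xz; exact: H.
Qed.

Lemma has_cderiv_cvg X f a l :
  has_cderiv X f a l <-> diff_quotient f a z @[z --> within X a^'] --> l.
Proof.
have dq z : z != a -> nrm (f z - f a - l * (z - a)) =
    nrm (l - diff_quotient f a z) * nrm (z - a).
  move=> za; have za0 : z - a != 0 by rewrite subr_eq0.
  by rewrite -nrmM mulrBl /diff_quotient divfK // -[in RHS]nrmN opprB.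
split=> [H|/cvgrPdist_le H e e0].
  apply/cvgrPdist_le => -[e e']; rewrite ltcE /= => /andP[/eqP e'0 e0]; subst e'.
  have [d d0 Hd] := H _ e0; apply/near_withinE; exists d => // z Xz za zd.
  rewrite normE lecR -(ler_pM2r (x := nrm (z - a))); last by rewrite nrm_gt0 subr_eq0.
  by rewrite -dq // Hd.
have e0' : 0 < e%:C by rewrite ltcR.
have /near_withinE[d d0 Hd] := H _ e0'; exists d => // z Xz zd.
have [->|za] := eqVneq z a; first by rewrite !subrr mulr0 subrr nrm0 mulr0.
rewrite dq //; apply: ler_wpM2r; first exact: nrm_ge0.
by rewrite -lecR -normE; exact: Hd.
Qed.

(** The absence of isolated points is what makes the limit defining the
    derivative unique. *)
Definition perfect X := forall a, X a -> ProperFilter (within X a^').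

Lemma has_cderivP X f a l : perfect X -> X a -> has_cderiv X f a l ->
  cdifferentiable X f a /\ cderiv X f a = l.
Proof.
move=> pX Xa /has_cderiv_cvg H; have PF := pX a Xa.
split; first by apply/cvg_ex; exists l.
exact: (cvg_lim (@norm_hausdorff _ _)).
Qed.

Lemma cdifferentiableP X f a : perfect X -> X a -> cdifferentiable X f a ->
  has_cderiv X f a (cderiv X f a).
Proof. by move=> pX Xa H; have PF := pX a Xa; apply/has_cderiv_cvg. Qed.

Lemma has_cderiv_ext X f g a l m : X a -> (forall z, X z -> f z = g z) ->
  l = m -> has_cderiv X f a l -> has_cderiv X g a m.
Proof.
move=> Xa fg <- H e /H[d d0 Hd]; exists d => // z Xz zd.
by rewrite -!fg //; exact: Hd.
Qed.

Lemma has_cderiv_cst X a l : has_cderiv X (fun=> l) a 0.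
Proof.
move=> e e0; exists 1 => // z _ _.
by rewrite subrr mul0r subrr nrm0 mulr_ge0 ?nrm_ge0 // ltW.
Qed.

Lemma has_cderiv_id X a : has_cderiv X id a 1.
Proof.
move=> e e0; exists 1 => // z _ _.
by rewrite mul1r subrr nrm0 mulr_ge0 ?nrm_ge0 // ltW.
Qed.

Lemma has_cderivD X f g a l m : has_cderiv X f a l -> has_cderiv X g a m ->
  has_cderiv X (fun z => f z + g z) a (l + m).
Proof.
move=> Hf Hg e e0; have e2 : 0 < e / 2 by rewrite divr_gt0.
have [d1 d10 H1] := Hf _ e2; have [d2 d20 H2] := Hg _ e2.
exists (Num.min d1 d2) => [|z Xz]; first by rewrite lt_min d10.
rewrite lt_min => /andP[z1 z2].
rewrite (_ : _ - _ - _ = (f z - f a - l * (z - a)) + (g z - g a - m * (z - a)));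
  last by ring.
apply: le_trans (nrmD _ _) _; rewrite [e]splitr mulrDl.
by apply: lerD; [exact: H1|exact: H2].
Qed.

Lemma has_cderiv_lip X f a l : has_cderiv X f a l ->
  exists2 d : R, 0 < d & forall z, X z -> nrm (z - a) < d ->
    nrm (f z - f a) <= (nrm l + 1) * nrm (z - a).
Proof.
move=> /(_ 1 ltr01)[d d0 H]; exists d => // z Xz zd.
rewrite -[f z - f a](subrK (l * (z - a))).
apply: le_trans (nrmD _ _) _; rewrite [nrm l + 1]addrC mulrDl; apply: lerD.
  exact: H.
by rewrite nrmM.
Qed.

(** The error splits into the two first-order errors, weighted by the values at
    the base point, and the product of the two increments, which is of second
    order by [has_cderiv_lip]. *)
Lemma has_cderivM X f g a l m : has_cderiv X f a l -> has_cderiv X g a m ->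
  has_cderiv X (fun z => f z * g z) a (l * g a + f a * m).
Proof.
move=> Hf Hg e e0.
have [d1 d10 H1] := has_cderiv_lip Hf.
have [d2 d20 H2] := has_cderiv_lip Hg.
set A := nrm (f a) + nrm (g a) + 1.
have A0 : 0 < A by rewrite /A; have := nrm_ge0 (f a); have := nrm_ge0 (g a); lra.
set B := (nrm l + 1) * (nrm m + 1).
have B0 : 0 < B by apply: mulr_gt0; rewrite ltr_wpDl ?nrm_ge0.
have e2 : 0 < e / (2 * A) by rewrite divr_gt0 // mulr_gt0.
have [d3 d30 H3] := Hf _ e2; have [d4 d40 H4] := Hg _ e2.
have e3 : 0 < e / (2 * B) by rewrite divr_gt0 // mulr_gt0.
exists (Num.min (Num.min d1 d2) (Num.min (Num.min d3 d4) (e / (2 * B)))).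
  by rewrite !lt_min d10 d20 d30 d40 e3.
move=> z Xz; rewrite !lt_min => /andP[/andP[z1 z2] /andP[/andP[z3 z4] z5]].
rewrite (_ : _ - _ - _ = (f z - f a - l * (z - a)) * g a
   + f a * (g z - g a - m * (z - a)) + (f z - f a) * (g z - g a)); last by ring.
have {}H1 := H1 _ Xz z1; have {}H2 := H2 _ Xz z2.
have {}H3 := H3 _ Xz z3; have {}H4 := H4 _ Xz z4.
apply: le_trans (nrmD _ _) _; apply: le_trans (lerD (nrmD _ _) (lexx _)) _.
rewrite !nrmM; set D := nrm (z - a) in z5 H1 H2 H3 H4 *.
have D0 : 0 <= D by exact: nrm_ge0.
have T3 : nrm (f z - f a) * nrm (g z - g a) <= e / 2 * D.
  apply: le_trans (ler_pM (nrm_ge0 _) (nrm_ge0 _) H1 H2) _.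
  rewrite mulrACA -/B mulrA; apply: ler_wpM2r => //.
  have -> : e / 2 = B * (e / (2 * B)) by field; rewrite gt_eqF.
  by rewrite ler_pM2l // ltW.
have T1 : nrm (f z - f a - l * (z - a)) * nrm (g a) + nrm (f a) * nrm (g z - g a - m * (z - a))
   <= e / 2 * D.
  apply: le_trans (lerD (ler_wpM2r (nrm_ge0 _) H3) (ler_wpM2l (nrm_ge0 _) H4)) _.
  have -> : e / 2 * D = e / (2 * A) * D * A by field; rewrite gt_eqF.
  rewrite [nrm (f a) * _]mulrC -mulrDr; apply: ler_wpM2l.
    by rewrite mulr_ge0 // ltW.
  by rewrite /A; lra.
by have := lerD T1 T3; lra.
Qed.

Lemma has_cderivZ X f a l c : has_cderiv X f a l ->
  has_cderiv X (fun z => c * f z) a (c * l).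
Proof.
move=> H; have := has_cderivM (has_cderiv_cst X a c) H.
by rewrite mul0r add0r.
Qed.

Lemma has_cderiv_comp X Y phi f a l m : (forall z, X z -> Y (phi z)) ->
  has_cderiv X phi a m -> has_cderiv Y f (phi a) l ->
  has_cderiv X (f \o phi) a (l * m).
Proof.
move=> XY Hp Hf e e0; have [d1 d10 H1] := has_cderiv_lip Hp.
have K0 : 0 < nrm m + 1 by rewrite ltr_wpDl ?nrm_ge0.
have L0 : 0 < nrm l + 1 by rewrite ltr_wpDl ?nrm_ge0.
have eK : 0 < e / (2 * (nrm m + 1)) by rewrite divr_gt0 // mulr_gt0.
have eL : 0 < e / (2 * (nrm l + 1)) by rewrite divr_gt0 // mulr_gt0.
have [d2 d20 H2] := Hf _ eK; have [d3 d30 H3] := Hp _ eL.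
exists (Num.min d1 (Num.min (d2 / (nrm m + 1)) d3)).
  by rewrite !lt_min d10 d30 divr_gt0.
move=> z Xz; rewrite !lt_min => /and3P[z1 z2 z3] /=.
have {}H1 := H1 _ Xz z1; have {}H3 := H3 _ Xz z3.
have zd : nrm (phi z - phi a) < d2.
  by apply: le_lt_trans H1 _; rewrite mulrC -ltr_pdivlMr.
have {}H2 := H2 _ (XY _ Xz) zd.
rewrite (_ : _ - _ - _ = (f (phi z) - f (phi a) - l * (phi z - phi a))
   + l * (phi z - phi a - m * (z - a))); last by ring.
apply: le_trans (nrmD _ _) _; rewrite nrmM [e]splitr mulrDl; apply: lerD.
  apply: le_trans H2 _; apply: le_trans (ler_wpM2l (ltW eK) H1) _.
  rewrite le_eqVlt; apply/orP; left; apply/eqP; field.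
  by rewrite gt_eqF.
apply: le_trans (ler_wpM2l (nrm_ge0 _) H3) _.
have -> : e / 2 * nrm (z - a) = (nrm l + 1) * (e / (2 * (nrm l + 1)) * nrm (z - a)).
  by field; rewrite gt_eqF.
apply: ler_wpM2r; last by rewrite lerDl.
by rewrite mulr_ge0 ?nrm_ge0 // ltW.
Qed.

End Derivative.

(** * Majorant polynomials *)

Section Majorant.
Variable R : realType.
Implicit Types (p q : {poly R}) (beta y : nat -> R) (x e : R).

(** The Taylor polynomial at 0 of the power series whose m-th derivative at 0 is
    [beta m]. *)
Definition jet L beta := \poly_(m < L) (beta m / m`!%:R).
(** The constant term is removed, as for phi - phi(z): only the derivatives of
    order at least 1 enter a composition. *)
Definition inner N y := \poly_(k < N.+1) (if k == 0%N then 0 else y k).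

Lemma deriv_jet L beta : (jet L.+1 beta)^`() = jet L (beta \o S).
Proof.
apply/polyP => k; rewrite coef_deriv !coef_poly ltnS; case: ifP => // _.
  rewrite -[LHS]mulr_natr factS mulnC natrM invfM mulrA divfK //.
by rewrite mul0rn.
Qed.

Lemma coef_deriv_inner N y k : (k < N)%N -> (inner N y)^`()`_k = y k.+1 *+ k.+1.
Proof. by move=> kN; rewrite coef_deriv coef_poly ltnS kN. Qed.

Definition coef_ge0 (p : {poly R}) := forall k, 0 <= p`_k.

Lemma coef_ge0M p q : coef_ge0 p -> coef_ge0 q -> coef_ge0 (p * q).
Proof. by move=> Hp Hq k; rewrite coefM; apply: sumr_ge0 => i _; exact: mulr_ge0. Qed.

Lemma coef_ge0X p n : coef_ge0 p -> coef_ge0 (p ^+ n).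
Proof.
move=> Hp; elim: n => [|n IH] k; first by rewrite expr0 coef1 ler0n.
by rewrite exprS; exact: coef_ge0M.
Qed.

Lemma sum_coef_le_horner p e N : coef_ge0 p -> 0 <= e ->
  \sum_(n < N) p`_n * e ^+ n <= p.[e].
Proof.
move=> p0 e0; rewrite (@horner_coef_wide _ (maxn N (size p))) ?leq_maxr //.
rewrite (big_ord_widen _ (fun n => p`_n * e ^+ n) (leq_maxl N (size p))) big_mkcond /=.
by apply: ler_sum => n _; case: ifP => // _; rewrite mulr_ge0 // exprn_ge0.
Qed.

Lemma coef_exp_lt0 p m n : p`_0 = 0 -> (n < m)%N -> (p ^+ m)`_n = 0.
Proof.
move=> p0; elim: m n => [//|m IH] n nm; rewrite exprS coefM big1 // => -[[|k] kn] _ /=.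
  by rewrite p0 mul0r.
by rewrite IH ?mulr0 //; lia.
Qed.

Lemma coef_jet_comp L beta p n :
  (jet L beta \Po p)`_n = \sum_(m < L) beta m / m`!%:R * (p ^+ m)`_n.
Proof.
rewrite /jet poly_def raddf_sum coef_sum; apply: eq_bigr => m _.
by rewrite /= linearZ /= comp_Xn_poly coefZ.
Qed.

Lemma geometric_sum_le2 x N : 0 <= x -> x <= 2^-1 -> \sum_(k < N) x ^+ k <= 2.
Proof.
move=> x0 x1; elim: N => [|N IH]; first by rewrite big_ord0.
rewrite big_ord_recl expr0.
under eq_bigr do rewrite exprS.
by rewrite -mulr_sumr; nra.
Qed.


End Majorant.

(** * Iterated derivatives of products and compositions *)

Section HigherDerivatives.
Variables (R : realType) (X : set R[i]).
Hypothesis pX : perfect X.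
Implicit Types (f g phi : R[i] -> R[i]) (a z : R[i]).

(** Finite order is needed for induction: the derivative of f o phi is a product
    whose factors are known to have only one derivative less. *)
Definition ndifferentiable n f :=
  forall k a, (k < n)%N -> X a -> cdifferentiable X (cderivn X k f) a.

Lemma D_inftyE f : D_infty X f <-> forall n, ndifferentiable n f.
Proof.
split=> [H n k a _ Xa|H n a Xa]; first exact: H.
by apply: (H n.+1).
Qed.

Lemma cderivnSr n f : cderivn X n.+1 f = cderivn X n (cderiv X f).
Proof. by rewrite /cderivn iterSr. Qed.

Lemma has_cderivn n f k a : ndifferentiable n f -> (k < n)%N -> X a ->
  has_cderiv X (cderivn X k f) a (cderivn X k.+1 f a).
Proof. by move=> nf kn Xa; apply: cdifferentiableP => //; exact: nf. Qed.

Lemma D_infty_has_cderiv f k a : D_infty X f -> X a ->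
  has_cderiv X (cderivn X k f) a (cderivn X k.+1 f a).
Proof. by move=> /D_inftyE nf; apply: (has_cderivn (nf k.+1)). Qed.

(** A sequence of functions each of which is the derivative of the preceding one
    on X must be the sequence of iterated derivatives; this is how all iterated
    derivatives below are computed. *)
Lemma tower_cderivn n f (G : nat -> R[i] -> R[i]) :
  (forall z, X z -> G 0%N z = f z) ->
  (forall k a, (k < n)%N -> X a -> has_cderiv X (G k) a (G k.+1 a)) ->
  ndifferentiable n f /\
  forall k z, (k <= n)%N -> X z -> cderivn X k f z = G k z.
Proof.
move=> G0 HG.
have E k : (k <= n)%N -> forall z, X z -> cderivn X k f z = G k z.
  elim: k => [|k IH] kn z Xz; first by rewrite G0.
  have Hk : has_cderiv X (cderivn X k f) z (G k.+1 z).
    by apply: (has_cderiv_ext Xz _ erefl (HG _ _ kn Xz)) => w Xw; rewrite IH // ltnW.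
  by have [_ <-] := has_cderivP pX Xz Hk.
split=> [k a kn Xa|k z kn Xz]; last exact: E.
apply: (proj1 (has_cderivP pX Xa (l := G k.+1 a) _)).
by apply: (has_cderiv_ext Xa _ erefl (HG _ _ kn Xa)) => w Xw; rewrite E // ltnW.
Qed.

Lemma tower_D_infty f (G : nat -> R[i] -> R[i]) :
  (forall z, X z -> G 0%N z = f z) ->
  (forall k a, X a -> has_cderiv X (G k) a (G k.+1 a)) ->
  D_infty X f /\ forall k z, X z -> cderivn X k f z = G k z.
Proof.
move=> G0 HG; split=> [|k z Xz].
  by apply/D_inftyE => n; apply: (proj1 (tower_cderivn G0 _)) => k a _; exact: HG.
by apply: (proj2 (tower_cderivn (n := k) G0 _)) => // j a _; exact: HG.
Qed.

Lemma ndifferentiable_ext n f g : (forall z, X z -> f z = g z) ->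
  ndifferentiable n f -> ndifferentiable n g /\
  forall k z, (k <= n)%N -> X z -> cderivn X k g z = cderivn X k f z.
Proof.
move=> fg nf; apply: tower_cderivn => // k a kn Xa; exact: (has_cderivn nf).
Qed.

Lemma ndifferentiableS n f : ndifferentiable n.+1 f <->
  (forall a, X a -> cdifferentiable X f a) /\ ndifferentiable n (cderiv X f).
Proof.
split=> [H|[H0 H] [|k] a kn Xa]; last 2 first.
- exact: H0.
- by rewrite cderivnSr; exact: H.
split=> [a Xa|k a kn Xa]; first exact: (H 0%N).
by rewrite -cderivnSr; exact: H.
Qed.

Definition leibniz (F G : nat -> R[i] -> R[i]) n z :=
  \sum_(k < n.+1) 'C(n, k)%:R * (F k z * G (n - k)%N z).

Lemma has_cderiv_sum n (F : nat -> R[i] -> R[i]) (l : nat -> R[i]) a :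
  (forall k, (k < n)%N -> has_cderiv X (F k) a (l k)) ->
  has_cderiv X (fun z => \sum_(k < n) F k z) a (\sum_(k < n) l k).
Proof.
elim: n => [|n IH] H.
  rewrite big_ord0 (_ : (fun z => _) = fun=> 0); first exact: has_cderiv_cst.
  by apply/funext => z; rewrite big_ord0.
rewrite big_ord_recr /= (_ : (fun z => _) = fun z => \sum_(k < n) F k z + F n z).
  by apply: has_cderivD; [apply: IH => k kn; apply: H; exact: ltnW|exact: H].
by apply/funext => z; rewrite big_ord_recr.
Qed.

(** Pascal's rule, summed: the coefficients of order n, shifted once in each
    factor, add up to those of order n + 1. *)
Lemma leibniz_pascal n (u v : nat -> R[i]) :
  \sum_(k < n.+1) 'C(n, k)%:R * (u k.+1 * v (n - k)%N + u k * v (n - k).+1) =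
  \sum_(k < n.+2) 'C(n.+1, k)%:R * (u k * v (n.+1 - k)%N).
Proof.
under eq_bigr do rewrite mulrDr.
rewrite big_split /= [RHS]big_ord_recl /= bin0 subn0.
rewrite [in RHS](eq_bigr (fun k : 'I_n.+1 => 'C(n, k.+1)%:R * (u k.+1 * v (n - k)%N)
  + 'C(n, k)%:R * (u k.+1 * v (n - k)%N))); last first.
  by move=> k _; rewrite /bump leq0n add1n binS natrD mulrDl subSS.
rewrite big_split /= [X in _ = _ + (X + _)]big_ord_recr /= bin_small // mul0r addr0.
rewrite [X in _ + X = _]big_ord_recl /= bin0 subn0.
rewrite addrCA; congr (_ + _); rewrite addrC; congr (_ + _).
by apply: eq_bigr => k _; rewrite /bump leq0n add1n -subSn // subSS.
Qed.

Lemma has_cderiv_leibniz n (F G : nat -> R[i] -> R[i]) a :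
  (forall k, (k <= n)%N -> has_cderiv X (F k) a (F k.+1 a)) ->
  (forall k, (k <= n)%N -> has_cderiv X (G k) a (G k.+1 a)) ->
  has_cderiv X (leibniz F G n) a (leibniz F G n.+1 a).
Proof.
move=> HF HG; rewrite /leibniz -(leibniz_pascal n (F^~ a) (G^~ a)).
apply: (has_cderiv_sum (F := fun k z => 'C(n, k)%:R * (F k z * G (n - k)%N z))
  (l := fun k => 'C(n, k)%:R * (F k.+1 a * G (n - k)%N a + F k a * G (n - k).+1 a))).
move=> k kn.
by apply: has_cderivZ; apply: has_cderivM; [exact: HF|apply: HG; exact: leq_subr].
Qed.

Lemma ndifferentiableM n f g : ndifferentiable n f -> ndifferentiable n g ->
  ndifferentiable n (fun z => f z * g z) /\
  forall k z, (k <= n)%N -> X z -> cderivn X k (fun z => f z * g z) z =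
    leibniz (cderivn X ^~ f) (cderivn X ^~ g) k z.
Proof.
move=> nf ng; apply: tower_cderivn => [z _|k a kn Xa].
  by rewrite /leibniz big_ord1 mul1r.
by apply: has_cderiv_leibniz => j jk; apply: (has_cderivn (n := n)) => //;
  exact: leq_ltn_trans kn.
Qed.

Section Composition.
Variable phi : R[i] -> R[i].
Hypothesis Xphi : forall z, X z -> X (phi z).

Lemma cderiv_comp f a : X a -> cdifferentiable X f (phi a) ->
  cdifferentiable X phi a -> cdifferentiable X (f \o phi) a /\
  cderiv X (f \o phi) a = cderiv X f (phi a) * cderiv X phi a.
Proof.
move=> Xa Hf Hp; apply: has_cderivP => //.
apply: (has_cderiv_comp Xphi); first exact: cdifferentiableP.
by apply: cdifferentiableP => //; exact: Xphi.
Qed.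

Lemma ndifferentiable_comp n f : ndifferentiable n f -> ndifferentiable n phi ->
  ndifferentiable n (f \o phi).
Proof.
elim: n f => [f _ _ k a|n IH f nf np]; first by rewrite ltn0.
have [df ndf] := (ndifferentiableS n f).1 nf.
have [dp ndp] := (ndifferentiableS n phi).1 np.
apply/ndifferentiableS; split=> [a Xa|].
  by apply: (proj1 (cderiv_comp Xa (df _ (Xphi Xa)) (dp _ Xa))).
have np' : ndifferentiable n phi by move=> k a kn; apply: np; exact: ltnW.
have [H _] := ndifferentiableM (IH _ ndf np') ndp.
apply: (proj1 (ndifferentiable_ext _ H)) => z Xz.
by rewrite (proj2 (cderiv_comp Xz (df _ (Xphi Xz)) (dp _ Xz))).
Qed.

Lemma D_infty_cderiv f : D_infty X f -> D_infty X (cderiv X f).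
Proof. by move=> H n a Xa; rewrite -cderivnSr; exact: H. Qed.

Lemma D_infty_comp f : D_infty X f -> D_infty X phi -> D_infty X (f \o phi).
Proof.
by move=> /D_inftyE nf /D_inftyE np; apply/D_inftyE => n; exact: ndifferentiable_comp.
Qed.

(** Leibniz' rule for the product (f' o phi) phi'. As a recursion on the order,
    with f' in place of f, it replaces the explicit formula of Faa di Bruno. *)
Lemma cderivn_comp n f z : D_infty X f -> D_infty X phi -> X z ->
  cderivn X n.+1 (f \o phi) z =
  \sum_(k < n.+1) 'C(n, k)%:R *
    (cderivn X k (cderiv X f \o phi) z * cderivn X (n - k).+1 phi z).
Proof.
move=> Df Dp Xz; rewrite cderivnSr.
have /D_inftyE H1 := D_infty_comp (D_infty_cderiv Df) Dp.
have /D_inftyE H2 := D_infty_cderiv Dp.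
have [H3 E] := ndifferentiableM (H1 n) (H2 n).
have [] := ndifferentiable_ext (g := cderiv X (f \o phi)) _ H3.
  move=> w Xw; rewrite (proj2 (cderiv_comp Xw _ _)) //.
    exact: (Df 0%N _ (Xphi Xw)).
  exact: (Dp 0%N).
move=> _ -> //; rewrite E //; apply: eq_bigr => k _.
by rewrite -cderivnSr.
Qed.

(** When the lower derivatives of f vanish at phi(a), only the term
    f^(n)(phi(a)) phi'(a)^n of Faa di Bruno's formula survives. *)
Lemma cderivn_comp_lead f n a : D_infty X f -> D_infty X phi -> X a ->
  (forall k, (k < n)%N -> cderivn X k f (phi a) = 0) ->
  cderivn X n (f \o phi) a = cderivn X n f (phi a) * cderiv X phi a ^+ n.
Proof.
move=> + Dp Xa; elim/ltn_ind: n f => -[|n] IH f Df H; first by rewrite mulr1.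
rewrite cderivn_comp // big_ord_recr big1 /=; last first.
  move=> k _; rewrite IH; last 3 first.
  - by rewrite ltnS ltnW.
  - exact: D_infty_cderiv.
  - by move=> j jk; rewrite -cderivnSr H // ltnS (ltn_trans jk).
  by rewrite -cderivnSr H ?ltnS // !mul0r mulr0.
rewrite add0r binn mul1r subnn IH; last 3 first.
- exact: ltnSn.
- exact: D_infty_cderiv.
- by move=> j jk; rewrite -cderivnSr; exact: H.
by rewrite -cderivnSr -mulrA exprSr.
Qed.

(** Cauchy's method of majorants. The recursion [cderivn_comp] has nonnegative
    coefficients, and the power series q o p obey it as well, since
    (q o p)' = (q' o p) p' and the derivative of the jet of [beta] is the jet of
    the shifted sequence. So bounds on the derivatives of f and phi carry over to
    f o phi. The truncation orders L and N are free, so that a single pair of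
    polynomials can serve all orders up to a given one. *)
Lemma cderivn_comp_majorant f (beta y : nat -> R) L N n z :
  D_infty X f -> D_infty X phi -> X z ->
  (forall m w, X w -> nrm (cderivn X m f w) <= beta m) ->
  (forall k w, X w -> nrm (cderivn X k.+1 phi w) <= k.+1`!%:R * y k.+1) ->
  (n < L)%N -> (n <= N)%N ->
  nrm (cderivn X n (f \o phi) z) <= n`!%:R * (jet L beta \Po inner N y)`_n.
Proof.
move=> + Dp Xz + Hy.
elim/ltn_ind: n f beta L => -[|n] IH f beta [//|L] Df Hb nL nN.
  (* the value of the jet at the zero of the inner polynomial is beta 0 *)
  apply: le_trans (Hb 0%N (phi z) (Xphi Xz)) _.
  rewrite fact0 mul1r -horner_coef0 horner_comp.
  rewrite (_ : (inner N y).[0] = 0); last by rewrite horner_coef0 coef_poly.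
  by rewrite horner_coef0 coef_poly /= fact0 divr1.
have -> : (n.+1)`!%:R * (jet L.+1 beta \Po inner N y)`_n.+1 =
  n`!%:R * ((jet L (beta \o S) \Po inner N y) * (inner N y)^`())`_n.
  rewrite -deriv_jet -deriv_comp coef_deriv factS natrM -[X in _ = _ * X]mulr_natr.
  by ring.
rewrite cderivn_comp // coefM mulr_sumr.
apply: le_trans (nrm_sum _ (fun k => 'C(n, k)%:R *
    (cderivn X k (cderiv X f \o phi) z * cderivn X (n - k).+1 phi z))) _.
apply: ler_sum => k _; have kn : (k <= n)%N by rewrite -ltnS.
have {}IH : nrm (cderivn X k (cderiv X f \o phi) z) <=
    k`!%:R * (jet L (beta \o S) \Po inner N y)`_k.
  apply: IH.
  - exact: ltn_ord.
  - exact: D_infty_cderiv.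
  - by move=> m w Xw; rewrite -cderivnSr; exact: Hb.
  - exact: leq_ltn_trans kn _.
  - by apply: leq_trans kn _; exact: ltnW.
rewrite !nrmM nrm_nat coef_deriv_inner; last by apply: leq_ltn_trans nN; exact: leq_subr.
apply: le_trans (ler_wpM2l (ler0n _ _) (ler_pM (nrm_ge0 _) (nrm_ge0 _) IH (Hy _ _ Xz))) _.
rewrite -(bin_fact kn) factS !natrM -[y _ *+ _]mulr_natr.
by rewrite le_eqVlt; apply/orP; left; apply/eqP; ring.
Qed.

End Composition.
End HigherDerivatives.

(** * Mean value inequalities on the unit circle *)

Section MeanValue.
Variable R : realType.
Implicit Types (f g G : R[i] -> R[i]) (w z l : R[i]) (s t r : R).

(** The real line as a subset of the plane, so that curves can be treated as
    functions with a derivative along a set. *)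
Definition real_line : set R[i] := range (fun t => t%:C).

Lemma is_derive_Re G l t : has_cderiv real_line G t%:C l ->
  is_derive t 1 (fun s => complex.Re (G s%:C)) (complex.Re l).
Proof.
move=> H.
suff C : h^-1 *: (((fun s => complex.Re (G s%:C)) \o shift t) (h *: 1) -
      complex.Re (G t%:C)) @[h --> 0^'] --> complex.Re l.
  apply: DeriveDef; first by apply/cvg_ex; exists (complex.Re l).
  exact: (cvg_lim (@norm_hausdorff _ _)).
apply/cvgrPdist_le => e e0; have [d d0 Hd] := H e e0.
near=> h.
have h0 : h != 0 by near: h; exact: nbhs_dnbhs_neq.
have hd : `|h| < d by near: h; exact: dnbhs0_lt.
rewrite /= /shift /= scaler1 -normrN opprB -[complex.Re l](mulKf h0) -scalerBr.
rewrite normrZ normfV ler_pdivrMl ?normr_gt0 // [leRHS]mulrC.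
have hE : (h + t)%:C - t%:C = h%:C :> R[i] by rewrite -rmorphB addrK.
have Lh : real_line (h + t)%:C by exists (h + t).
have := Hd _ Lh; rewrite hE !nrm_real => /(_ hd); apply: le_trans.
apply: le_trans (Re_le_nrm _); rewrite le_eqVlt; apply/orP; left; apply/eqP.
congr `|_|; rewrite !raddfB /=; congr (_ - _).
by case: (l) => a b /=; rewrite mulr0 subr0 mulrC.
Unshelve. all: by end_near. Qed.

(** With D the total increment, the mean value theorem for the real function
    Re (conj(D) G) gives |D|^2 <= |D| K (t - s), without the loss of a constant
    that separate real and imaginary parts would cause. *)
Lemma line_mean_value G (G' : R[i] -> R[i]) K s t : s <= t ->
  (forall r, s <= r <= t -> has_cderiv real_line G r%:C (G' r%:C) /\
     nrm (G' r%:C) <= K) ->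
  nrm (G t%:C - G s%:C) <= K * (t - s).
Proof.
move=> st H; set D := G t%:C - G s%:C.
have [->|D0] := eqVneq D 0.
  rewrite nrm0 mulr_ge0 ?subr_ge0 //; have [|_] := H s; first by rewrite lexx.
  by apply: le_trans; exact: nrm_ge0.
pose h r := complex.Re (D^*%C * G r%:C).
pose h' r := complex.Re (D^*%C * G' r%:C).
have dh r : s <= r <= t -> is_derive r 1 h (h' r).
  by move=> /H[Hr _]; apply: (is_derive_Re (G := fun z => D^*%C * G z)); exact: has_cderivZ.
have [||r rst hr] := MVT_segment (f := h) (df := h') st.
- by move=> x /itvP xst; apply: dh; rewrite !xst.
- apply: derivable_within_continuous => x /itvP xst.
  by have [] : is_derive x 1 h (h' x) by apply: dh; rewrite !xst.
have nD : nrm D ^+ 2 = h t - h s.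
  rewrite /h -raddfB -mulrBr -/D sqr_nrm.
  by case: (D) => a b /=; rewrite mulNr opprK -!expr2.
have [_ Kr] : has_cderiv real_line G r%:C (G' r%:C) /\ nrm (G' r%:C) <= K.
  by apply: H; move: rst; rewrite in_itv.
have Dp : 0 < nrm D by rewrite nrm_gt0.
rewrite -(ler_pM2l Dp) -expr2 nD hr mulrA; apply: ler_wpM2r; first by rewrite subr_ge0.
apply: le_trans (ler_norm _) _; apply: le_trans (Re_le_nrm _) _.
have -> : nrm (D^*%C * G' r%:C) = nrm D * nrm (G' r%:C).
  by rewrite nrmM; congr (_ * _); case: (D) => a b /=; rewrite sqrrN.
by rewrite ler_pM2l.
Qed.

End MeanValue.

Section Circle.
Variable R : realType.
Implicit Types (f g : R[i] -> R[i]) (u w z l : R[i]) (s t r : R).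
Local Notation Gamma := (unit_circle R).

(** The Cayley transform maps the real line to the unit circle minus the point
    -1, by a rational function whose derivative and inverse are explicit. *)
Definition cayley z := (1 + 'i * z) / (1 - 'i * z).

Let nrm_i : nrm ('i : R[i]) = 1.
Proof. by rewrite /= expr0n add0r expr1n sqrtr1. Qed.

Let den_ge1 t : 1 <= nrm (1 - 'i * t%:C).
Proof.
apply: le_trans (Re_le_nrm _); rewrite /=.
by rewrite (_ : 1 - _ = 1) ?normr1 //; ring.
Qed.

Let den_neq0 t : 1 - 'i * t%:C != 0 :> R[i].
Proof. by rewrite -nrm_gt0 (lt_le_trans ltr01). Qed.

Lemma nrm_cayley t : nrm (cayley t%:C) = 1.
Proof.
rewrite /cayley nrmM nrmV.
suff -> : nrm (1 + 'i * t%:C) = nrm (1 - 'i * t%:C).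
  by rewrite divff // nrm_eq0.
rewrite /=; congr Num.sqrt; ring.
Qed.

Lemma cayleyB s t : cayley t%:C - cayley s%:C =
  2%:R * 'i * (t%:C - s%:C) / ((1 - 'i * t%:C) * (1 - 'i * s%:C)).
Proof. by rewrite /cayley; field; rewrite !den_neq0. Qed.

Definition cayley' z := 2%:R * 'i / (1 - 'i * z) ^+ 2.

Lemma nrm_cayley' t : nrm (cayley' t%:C) <= 2.
Proof.
rewrite /cayley' !nrmM nrmV nrm_nat nrm_i mulr1 nrmX.
rewrite -[leRHS]mulr1 ler_pM2l // invf_le1 ?exprn_ege1 //.
by rewrite exprn_gt0 // (lt_le_trans ltr01).
Qed.

Lemma cayley_lip s t : nrm (cayley t%:C - cayley s%:C) <= 2 * `|t - s|.
Proof.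
rewrite cayleyB !nrmM nrmV nrm_nat nrm_i mulr1 -rmorphB nrm_real.
rewrite -[leRHS]mulr1; apply: ler_wpM2l; first by rewrite mulr_ge0.
rewrite nrmM invf_le1; last by rewrite mulr_gt0 // (lt_le_trans ltr01).
by rewrite mulr_ege1.
Qed.

Lemma has_cderiv_cayley t : has_cderiv (@real_line R) cayley t%:C (cayley' t%:C).
Proof.
move=> e e0; exists (e / 2) => [|_ [s _ <-]]; first by rewrite divr_gt0.
rewrite -rmorphB !nrm_real => st.
have -> : cayley s%:C - cayley t%:C - cayley' t%:C * (s - t)%:C =
    2%:R * 'i * 'i * (s - t)%:C ^+ 2 / ((1 - 'i * s%:C) * (1 - 'i * t%:C) ^+ 2).
  rewrite cayleyB /cayley' rmorphB; field.
  by rewrite !den_neq0.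
rewrite nrmM nrmV (nrmM _ ((s - t)%:C ^+ 2)) (nrmX (s - t)%:C).
rewrite (nrmM _ ((1 - _) ^+ 2)) (nrmX (1 - _)) !nrmM nrm_nat nrm_i !mulr1 nrm_real.
apply: (@le_trans _ _ (2 * `|s - t| ^+ 2)).
  rewrite -[leRHS]mulr1; apply: ler_wpM2l; first by rewrite mulr_ge0 // exprn_ge0.
  rewrite invf_le1; last first.
    by rewrite mulr_gt0 ?exprn_gt0 // (lt_le_trans ltr01).
  by rewrite mulr_ege1 // exprn_ege1.
rewrite expr2 mulrA; apply: ler_wpM2r; first by rewrite normr_ge0.
by rewrite mulrC -ler_pdivlMr // ltW.
Qed.

(** The parameter of u = x + iy is y / (1 + x), the tangent of half the argument
    of u; near 1 the denominator is at least 1. *)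
Lemma cayley_surj u : nrm u = 1 -> nrm (u - 1) <= 1 ->
  exists2 t, u = cayley t%:C & `|t| <= nrm (u - 1).
Proof.
case: u => x y n1 n2.
have xy : x ^+ 2 + y ^+ 2 = 1.
  by have := sqr_nrm (x +i* y); rewrite n1 expr1n.
have x2 : 2^-1 <= x.
  have : (nrm ((x +i* y) - 1)) ^+ 2 <= 1 by rewrite expr_le1 // nrm_ge0.
  by rewrite sqr_nrm /= subr0; nra.
have x1 : 0 < 1 + x by lra.
exists (y / (1 + x)).
  apply: (mulIf (den_neq0 (y / (1 + x)))); rewrite /cayley divfK //.
  have yE : x + y * (y / (1 + x)) = 1.
    apply: (mulIf (lt0r_neq0 x1)); rewrite mulrDl mulrA divfK ?lt0r_neq0 //.
    by move: xy; nra.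
  have xE : y - x * (y / (1 + x)) = y / (1 + x).
    apply: (mulIf (lt0r_neq0 x1)); rewrite mulrBl mulrA !divfK ?lt0r_neq0 //.
    by ring.
  move: yE xE; set T := y / _ => yE xE.
  apply/eqP; rewrite eq_complex /=; apply/andP; split; apply/eqP.
    by transitivity (x + y * T); [|rewrite yE]; ring.
  by transitivity (y - x * T); [|rewrite xE]; ring.
rewrite normrM normfV (gtr0_norm x1); apply: (@le_trans _ _ `|y|).
  by rewrite ler_pdivrMr // ler_peMr //; lra.
by apply: le_trans (Im_le_nrm _); rewrite /= subr0.
Qed.

(** The arc from w to z is the image of a real segment of length at most
    |z - w| under v |-> w cayley(v), which is 2-Lipschitz. The bound on the
    derivative is only asked for at points within 2|z - w| of w, hence on that
    arc; this is what allows the second-order estimate [circle_taylor]. *)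
Lemma circle_mean_value f (f' : R[i] -> R[i]) K w z :
  Gamma w -> Gamma z -> nrm (z - w) <= 1 ->
  (forall v, Gamma v -> nrm (v - w) <= 2 * nrm (z - w) ->
    has_cderiv Gamma f v (f' v) /\ nrm (f' v) <= K) ->
  nrm (f z - f w) <= 2 * K * nrm (z - w).
Proof.
move=> /unit_circleE w1 /unit_circleE z1 zw H.
have w0 : w != 0 by rewrite -nrm_gt0 w1.
have uw : nrm (z / w - 1) = nrm (z - w).
  have -> : z - w = (z / w - 1) * w by rewrite mulrBl divfK // mul1r.
  by rewrite nrmM w1 mulr1.
have u1 : nrm (z / w) = 1 by rewrite nrmM nrmV w1 z1 divr1.
have [||T zwT] := @cayley_surj (z / w) => //; first by rewrite uw.
rewrite uw => Tle.
have c0 : cayley 0 = 1 by rewrite /cayley mulr0 subr0 addr0 divr1.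
pose gam v := w * cayley v.
have gamT : gam T%:C = z by rewrite /gam -zwT mulrCA divff ?mulr1.
have gam0 : gam 0%:C = w by rewrite /gam c0 mulr1.
have Ggam v : real_line v -> Gamma (gam v).
  by case=> t _ <-; apply/unit_circleE; rewrite nrmM w1 nrm_cayley mulr1.
have Hr r : `|r| <= `|T| ->
    has_cderiv (@real_line R) (f \o gam) r%:C (f' (gam r%:C) * (w * cayley' r%:C)) /\
    nrm (f' (gam r%:C) * (w * cayley' r%:C)) <= 2 * K.
  move=> rT; have Lr : real_line (r%:C : R[i]) by exists r.
  have [|Hf Kf] := H _ (Ggam _ Lr).
    rewrite -{1}gam0 /gam -mulrBr nrmM w1 mul1r; apply: le_trans (cayley_lip _ _) _.
    by rewrite subr0 ler_pM2l // (le_trans rT).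
  split; first exact: (has_cderiv_comp Ggam (has_cderivZ _ (has_cderiv_cayley r)) Hf).
  rewrite 2!nrmM w1 mul1r mulrC; apply: ler_pM => //; try exact: nrm_ge0.
  exact: nrm_cayley'.
have K0 : 0 <= 2 * K by apply: le_trans (nrm_ge0 _) (proj2 (Hr 0 _)); rewrite normr0.
apply: (@le_trans _ _ (2 * K * `|T|)); last by rewrite ler_wpM2l.
rewrite -gamT -gam0.
pose G' v := f' (gam v) * (w * cayley' v).
have [T0|T0] := lerP 0 T.
  rewrite (ger0_norm T0) -[in leRHS](subr0 T).
  apply: (line_mean_value (G := f \o gam) (G' := G') T0) => r /andP[r0 rT].
  by apply: Hr; rewrite !ger0_norm.
rewrite nrmB (ltr0_norm T0) -[- T]sub0r.
apply: (line_mean_value (G := f \o gam) (G' := G') (ltW T0)) => r /andP[r0 rT].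
by apply: Hr; rewrite (ltr0_norm T0) ler0_norm // lerN2.
Qed.

Lemma circle_lipschitz f (f' : R[i] -> R[i]) K w z :
  (forall v, Gamma v -> has_cderiv Gamma f v (f' v) /\ nrm (f' v) <= K) ->
  Gamma w -> Gamma z -> nrm (z - w) <= 1 ->
  nrm (f z - f w) <= 2 * K * nrm (z - w).
Proof.
by move=> H w1 z1 zw; apply: (circle_mean_value (f' := f')) => // v v1 _; exact: H.
Qed.

(** The mean value inequality for v |-> f(v) - f'(w) v, whose derivative is small
    near w because f' is Lipschitz. *)
Lemma circle_taylor f (f' f'' : R[i] -> R[i]) K w z :
  (forall v, Gamma v -> has_cderiv Gamma f v (f' v)) ->
  (forall v, Gamma v -> has_cderiv Gamma f' v (f'' v) /\ nrm (f'' v) <= K) ->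
  Gamma w -> Gamma z -> nrm (z - w) <= 2^-1 ->
  nrm (f z - f w - f' w * (z - w)) <= 8 * K * nrm (z - w) ^+ 2.
Proof.
move=> Hf Hf' w1 z1 zw.
pose g v := f v + (- f' w) * v.
rewrite (_ : f z - f w - f' w * (z - w) = g z - g w); last by rewrite /g; ring.
rewrite (_ : 8 * K * _ = 2 * (2 * K * (2 * nrm (z - w))) * nrm (z - w)); last by ring.
apply: (circle_mean_value (f' := fun v => f' v + (- f' w) * 1)) => //; first by lra.
move=> v v1 vw; split.
  by apply: has_cderivD; [exact: Hf|apply: has_cderivZ; exact: has_cderiv_id].
have K0 : 0 <= K by apply: le_trans (nrm_ge0 _) (proj2 (Hf' w w1)).
rewrite mulr1; apply: le_trans (circle_lipschitz Hf' w1 v1 _) _; first by lra.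
by rewrite ler_wpM2l // mulr_ge0.
Qed.

(** The points a cayley(t) with small t > 0 accumulate at a. *)
Lemma perfect_circle : perfect Gamma.
Proof.
move=> a /unit_circleE a1; split; last exact: within_filter.
move/near_withinE => [d d0 Hd].
have t0 : 0 < d / 4 by rewrite divr_gt0.
have c0 : cayley 0 = 1 by rewrite /cayley mulr0 subr0 addr0 divr1.
apply: (Hd (a * cayley (d / 4)%:C)).
- by apply/unit_circleE; rewrite nrmM a1 nrm_cayley mulr1.
- rewrite -subr_eq0 -{2}[a]mulr1 -c0 -mulrBr mulf_neq0 //; first by rewrite -nrm_gt0 a1.
  rewrite (cayleyB 0) -rmorphB subr0 !mulf_neq0 ?invr_neq0 ?mulf_neq0 ?den_neq0 //.
  + by rewrite -nrm_gt0 nrm_i.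
  + by rewrite -nrm_gt0 nrm_real normr_gt0 gt_eqF.
- rewrite -{2}[a]mulr1 -c0 -mulrBr nrmM a1 mul1r.
  apply: le_lt_trans (cayley_lip 0 _) _; rewrite subr0 gtr0_norm //; lra.
Qed.

End Circle.

(** * The norm of D(X, M) in terms of real bounds *)

Section DNorm.
Variables (R : realType) (X : set R[i]) (M : nat -> R).
Hypotheses (X0 : X !=set0) (M0 : forall n, 0 < M n).
Implicit Types (f g : R[i] -> R[i]) (K : R).

Lemma supnorm_le f K : (forall z, X z -> nrm (f z) <= K) ->
  (supnorm X f <= K%:E)%E.
Proof. by move=> H; apply: ub_ereal_sup => _ [z Xz <-]; rewrite lee_fin H. Qed.

Lemma le_supnorm f z : X z -> ((nrm (f z))%:E <= supnorm X f)%E.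
Proof. by move=> Xz; apply: ereal_sup_ubound; exists z. Qed.

Lemma supnorm_ge0 f : (0 <= supnorm X f)%E.
Proof.
case: X0 => z Xz; apply: le_trans (le_supnorm f Xz).
by rewrite lee_fin nrm_ge0.
Qed.

Lemma D_norm_term_ge0 f n : (0 <= supnorm X (cderivn X n f) * ((M n)^-1)%:E)%E.
Proof. by rewrite mule_ge0 ?supnorm_ge0 // lee_fin invr_ge0 ltW. Qed.

Lemma D_norm_ge0 f : (0 <= D_norm X M f)%E.
Proof. by apply: nneseries_ge0 => n _ _; exact: D_norm_term_ge0. Qed.

(** The bounds may depend on the length of the partial sum, because majorants
    obtained from truncated power series do. *)
Lemma D_norm_le f K :
  (forall N, exists2 beta : nat -> R,
     forall n z, (n < N)%N -> X z -> nrm (cderivn X n f z) <= beta n &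
     \sum_(n < N) beta n / M n <= K) ->
  (D_norm X M f <= K%:E)%E.
Proof.
move=> H; apply: lime_le.
  by apply: is_cvg_ereal_nneg_natsum => n _; exact: D_norm_term_ge0.
apply: nearW => N; have [beta Hb S] := H N.
rewrite big_mkord; apply: (@le_trans _ _ (\sum_(n < N) beta n / M n)%:E); last by rewrite lee_fin.
rewrite -sumEFin; apply: lee_sum => n _; rewrite EFinM.
apply: lee_wpmul2r; first by rewrite lee_fin invr_ge0 ltW.
by apply: supnorm_le => z Xz; exact: Hb.
Qed.

Lemma D_norm_bounds f K : (D_norm X M f <= K%:E)%E ->
  exists beta : nat -> R,
    (forall n z, X z -> nrm (cderivn X n f z) <= beta n) /\
    (forall N, \sum_(n < N) beta n / M n <= K).
Proof.
move=> H.
have part N : (\sum_(n < N) supnorm X (cderivn X n f) * ((M n)^-1)%:E <= K%:E)%E.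
  apply: le_trans H.
  rewrite -(big_mkord xpredT (fun n => supnorm X (cderivn X n f) * ((M n)^-1)%:E)%E).
  by apply: nneseries_lim_ge => n _ _; exact: D_norm_term_ge0.
have fin n : supnorm X (cderivn X n f) \is a fin_num.
  rewrite ge0_fin_numE ?supnorm_ge0 //.
  have : (supnorm X (cderivn X n f) * ((M n)^-1)%:E <= K%:E)%E.
    apply: le_trans (part n.+1); rewrite big_ord_recr /= leeDr //.
    by apply: sume_ge0 => k _; exact: D_norm_term_ge0.
  rewrite lee_pdivrMr // => /le_lt_trans; apply.
  by rewrite -EFinM ltry.
exists (fun n => fine (supnorm X (cderivn X n f))); split=> [n z Xz|N].
  by rewrite -lee_fin fineK // le_supnorm.
rewrite -lee_fin; apply: le_trans (part N); rewrite -sumEFin.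
by apply: lee_sum => n _; rewrite EFinM fineK.
Qed.

Lemma dales_davieP f : dales_davie X M f <->
  D_infty X f /\ exists K, (D_norm X M f <= K%:E)%E.
Proof.
split=> -[Df]; last first.
  by move=> [K H]; split=> //; apply: le_lt_trans H _; exact: ltry.
move=> H; split=> //; exists (fine (D_norm X M f)).
by rewrite fineK // ge0_fin_numE // D_norm_ge0.
Qed.

End DNorm.

(** * Limits along ultrafilters *)

Section Ultrafilter.
Variable R : realType.

Lemma ultra_limit_real (U : set_system nat) (v : nat -> R) b :
  UltraFilter U -> (forall n, `|v n| <= b) ->
  exists l, forall e, 0 < e -> U [set n | `|v n - l| < e].
Proof.
move=> UU vb; have PF : ProperFilter (v @ U) by exact: fmap_proper_filter.
have [|l [_ lU]] := @segment_compact R (- b) b (v @ U) PF.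
  apply: (@filterS _ U _ setT) (filterT) => n _ /=.
  by rewrite in_itv /= -ler_norml.
exists l => e e0; set S := [set n | _]; have [//|H] := in_ultra_setVsetC S UU.
have [|y [[n nH <-] ly]] := lU (v @` (~` S)) (ball l e) _ (nbhsx_ballx _ _ e0).
  by apply: (@filterS _ U _ _ _ _ H) => n Hn; exists n.
by case: nH; rewrite /S /= distrC.
Qed.

(** A limit along an ultrafilter exists for every bounded sequence. With one
    ultrafilter fixed once and for all, infinitely many sequences (all
    derivatives at all points) get limits simultaneously, which spares every
    diagonal extraction. *)
Lemma ultra_limit (U : set_system nat) (v : nat -> R[i]) b :
  UltraFilter U -> (forall n, nrm (v n) <= b) ->
  exists l, forall e, 0 < e -> U [set n | nrm (v n - l) < e].
Proof.
move=> UU vb.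
have [|x Hx] := @ultra_limit_real U (fun n => complex.Re (v n)) b UU.
  by move=> n; apply: le_trans (Re_le_nrm _) (vb n).
have [|y Hy] := @ultra_limit_real U (fun n => complex.Im (v n)) b UU.
  by move=> n; apply: le_trans (Im_le_nrm _) (vb n).
exists (x +i* y) => e e0; have e2 : 0 < e / 2 by rewrite divr_gt0.
apply: filterS (filterI (Hx _ e2) (Hy _ e2)) => n /= [nx ny].
apply: le_lt_trans (nrm_le_ReIm _) _; rewrite [e]splitr.
by case: (v n) nx ny => a c /=; exact: ltrD.
Qed.

End Ultrafilter.

(** Sets of an ultrafilter finer than the Frechet filter are infinite, so a
    choice of one element in each of the sets S k can be made increasing. *)
Lemma ultra_subsequence (U : set_system nat) (S : nat -> set nat) :
  UltraFilter U -> \oo `<=` U -> (forall k, U (S k)) ->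
  exists s : nat -> nat, {homo s : m n / (m < n)%N} /\ forall k, S k (s k).
Proof.
move=> UU ooU US.
have /choice[next Hnext] : forall kn : nat * nat, exists n, (kn.2 < n)%N /\ S kn.1 n.
  move=> [k n].
  have Un : U [set j | (n < j)%N] by apply: ooU; exact: nbhs_infty_gt.
  by have [j /= []] := filter_ex (filterI Un (US k)); exists j.
pose s := fix s k := if k is j.+1 then next (j.+1, s j) else next (0%N, 0%N).
exists s; split; last first.
  by case=> [|k]; [have [] := Hnext (0%N, 0%N)|have [] := Hnext (k.+1, s k)].
by apply: homo_ltn => [|k]; [exact: ltn_trans|have [] := Hnext (k.+1, s k)].
Qed.

(** * The norm of a composition with an analytic map *)

Section WeightSequence.
Variables (R : realType) (M : nat -> R).
Hypotheses (hM : weight_sequence M) (hna : nonanalytic M).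

Lemma weight_gt0 n : 0 < M n. Proof. by case: hM. Qed.

(** The defining inequality of weight sequences, written so that it compares the
    coefficient of f^(m) in (f o phi)^(n) with the term of index n - m of the
    sequence k! / M_k, which is small. *)
Lemma fact_weight_ratio m n : (m <= n)%N ->
  n`!%:R / M n * (M m / m`!%:R) <= (n - m)`!%:R / M (n - m)%N.
Proof.
move=> mn; case: hM => M0 _ /(_ (n - m)%N m); rewrite subnKC //.
have f0 k : 0 < (k`!%:R : R) by rewrite ltr0n fact_gt0.
rewrite -(bin_fact mn) !natrM ler_pdivlMr ?mulr_gt0 // => H.
rewrite ler_pdivlMr // -(ler_pM2r (M0 n)).
have -> : 'C(n, m)%:R * (m`!%:R * (n - m)`!%:R) / M n * (M m / m`!%:R) * M (n - m)%N * M n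
  = (n - m)`!%:R * ('C(n, m)%:R * (M m * M (n - m)%N)) :> R.
  by field; rewrite !gt_eqF.
by rewrite ler_pM2l.
Qed.

Lemma fact_weight_geometric e : 0 < e ->
  exists2 A, 0 < A & forall k, k`!%:R / M k <= A * e ^+ k.
Proof.
move=> e0; have f0 k : 0 <= k`!%:R / M k by rewrite divr_ge0 // ltW // weight_gt0.
have [n0 _ Hn0] : \forall k \near \oo, k`!%:R / M k <= e ^+ k.
  have /cvgrPdist_lt/(_ _ e0) := hna.
  apply: filterS2 (nbhs_infty_gt 0) => k k0.
  rewrite sub0r normrN ger0_norm ?powR_ge0 // => /ltW H.
  have <- : ((k`!%:R / M k) `^ k%:R^-1) ^+ k = k`!%:R / M k.
    by rewrite -powR_mulrn ?powR_ge0 // -powRrM mulVf ?powRr1 // pnatr_eq0 -lt0n.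
  by apply: lerXn2r; rewrite // nnegrE ?powR_ge0 // ltW.
have T0 k : 0 <= k`!%:R / M k / e ^+ k by rewrite divr_ge0 // exprn_ge0 // ltW.
have S0 : 0 <= \sum_(k < n0) k`!%:R / M k / e ^+ k by exact: sumr_ge0.
exists (1 + \sum_(k < n0) k`!%:R / M k / e ^+ k); first by rewrite ltr_pwDl.
move=> k; have ek : 0 < e ^+ k by rewrite exprn_gt0.
have [kn|kn] := ltnP k n0; last first.
  by apply: le_trans (Hn0 _ kn) _; rewrite ler_peMl ?(ltW ek) // lerDl.
rewrite -ler_pdivrMr // (bigD1 (Ordinal kn)) //= addrCA lerDl addr_ge0 //.
exact: sumr_ge0.
Qed.

Definition geometric_comp_bound (X : set R[i]) (phi : R[i] -> R[i]) (A rho : R) :=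
  forall f (beta : nat -> R), D_infty X f ->
    (forall m z, X z -> nrm (cderivn X m f z) <= beta m) ->
    forall N, exists2 beta' : nat -> R,
      forall n z, (n < N)%N -> X z -> nrm (cderivn X n (f \o phi) z) <= beta' n &
      \sum_(n < N) beta' n / M n <= \sum_(m < N) A * rho ^+ m * (beta m / M m).

Section CompositionBound.
Variables (X : set R[i]) (phi : R[i] -> R[i]) (r C : R).
Hypotheses (pX : perfect X) (X0 : X !=set0) (Xphi : forall z, X z -> X (phi z)).
Hypotheses (Dphi : D_infty X phi) (r0 : 0 <= r) (r1 : r < 1) (C1 : 1 <= C).
Hypothesis Hr : forall z, X z -> nrm (cderiv X phi z) <= r.
Hypothesis HC : forall k z, X z -> nrm (cderivn X k.+1 phi z) <= k.+1`!%:R * C ^+ k.+1.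

Let y k := if k == 1%N then r else C ^+ k.
(* small enough for the quadratic tail of p(e) to be at most e (1 - r) / 2 *)
Let e := (1 - r) / (4 * C ^+ 2).
(* any number strictly between r and 1 *)
Let rho := (1 + r) / 2.

Let C0 : 0 < C. Proof. exact: lt_le_trans C1. Qed.
Let e0 : 0 < e. Proof. by rewrite divr_gt0 ?subr_gt0 // mulr_gt0 // exprn_gt0. Qed.

Let inner_small N : (inner N y).[e] <= rho * e.
Proof.
rewrite horner_poly big_ord_recl /= mul0r add0r.
case: N => [|N]; first by rewrite big_ord0 mulr_ge0 ?ltW // divr_gt0 // ltr_wpDr.
rewrite big_ord_recl /= /bump /= expr1.
rewrite (eq_bigr (fun k : 'I_N => (C * e) ^+ 2 * (C * e) ^+ k)); last first.
  by move=> k _; rewrite !add1n /y /= -exprMn -exprD.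
have Ce : C * e <= 2^-1.
  have -> : C * e = (1 - r) / (4 * C) by rewrite /e; field; rewrite gt_eqF.
  rewrite ler_pdivrMr; last by rewrite mulr_gt0.
  by move: r0 C1; lra.
have := @geometric_sum_le2 R (C * e) N (mulr_ge0 (ltW C0) (ltW e0)) Ce.
rewrite -mulr_sumr; set S := \sum_(_ < N) _ => S2.
have E : (C * e) ^+ 2 * 2 = (1 - r) / 2 * e.
  by rewrite /e; field; rewrite gt_eqF.
have : (C * e) ^+ 2 * S <= (C * e) ^+ 2 * 2 by rewrite ler_wpM2l // sqr_ge0.
rewrite E /rho /y /=; move: e (_ * S) => t s; lra.
Qed.

Let y_bound k w : X w -> nrm (cderivn X k.+1 phi w) <= k.+1`!%:R * y k.+1.
Proof.
move=> Xw; case: k => [|k]; last exact: HC.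
by rewrite /y eqxx factS fact0 muln1 mul1r; exact: Hr.
Qed.

(** With p(t) = r t + C^2 t^2 + ... , the majorant gives f^(m) the total weight
    sum_n (n! M_m / (m! M_n)) [t^n] p(t)^m in the norm of f o phi. By
    [fact_weight_ratio] and non-analyticity this is at most
    A e^-m p(e)^m for any e > 0, and p(e) / e tends to r < 1 as e tends to 0. *)
Lemma composition_bound : exists A rho : R,
  [/\ 0 <= A, 0 <= rho, rho < 1 & geometric_comp_bound X phi A rho].
Proof.
have [A A0 HA] := fact_weight_geometric e0.
exists A, rho; split; [exact: ltW|by rewrite /rho; move: r0; lra|by rewrite /rho; move: r1; lra|].
move=> f beta Df Hb N.
pose p := inner N y.
exists (fun n => n`!%:R * (jet N beta \Po p)`_n).
  by move=> n z nN Xz; apply: (cderivn_comp_majorant pX Xphi Df Dphi Xz Hb y_bound nN); exact: ltnW.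
have p0 : p`_0 = 0 by rewrite coef_poly.
have pge0 : coef_ge0 p.
  move=> k; rewrite coef_poly; case: ifP => // _; case: ifP => // _.
  by rewrite /y; case: ifP => // _; rewrite exprn_ge0 // ltW.
under eq_bigr do rewrite coef_jet_comp // mulr_sumr mulr_suml.
rewrite exchange_big /=; apply: ler_sum => m _.
have b0 : 0 <= beta m / M m.
  case: X0 => x Xx; rewrite divr_ge0 ?(ltW (weight_gt0 m)) //.
  by apply: le_trans (Hb m x Xx); exact: nrm_ge0.
have cge0 : coef_ge0 (p ^+ m) by exact: coef_ge0X.
have em : 0 < e ^+ m by rewrite exprn_gt0.
rewrite -(ler_pM2r em) mulr_suml.
apply: (@le_trans _ _ (\sum_(n < N) beta m / M m * A * ((p ^+ m)`_n * e ^+ n))).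
  apply: ler_sum => n _; have [nm|mn] := ltnP n m.
    by rewrite coef_exp_lt0 // !(mulr0, mul0r).
  have -> : n`!%:R * (beta m / m`!%:R * (p ^+ m)`_n) / M n * e ^+ m =
      beta m / M m * (p ^+ m)`_n * e ^+ m * (n`!%:R / M n * (M m / m`!%:R)).
    by field; rewrite !gt_eqF ?weight_gt0 // ltr0n fact_gt0.
  have -> : beta m / M m * A * ((p ^+ m)`_n * e ^+ n) =
      beta m / M m * (p ^+ m)`_n * e ^+ m * (A * e ^+ (n - m)).
    have -> : e ^+ n = e ^+ (n - m) * e ^+ m by rewrite -exprD subnK.
    by ring.
  apply: ler_wpM2l; first exact: (mulr_ge0 (mulr_ge0 b0 (cge0 n)) (ltW em)).
  by apply: le_trans (fact_weight_ratio mn) (HA _).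
rewrite -mulr_sumr.
have S : \sum_(n < N) (p ^+ m)`_n * e ^+ n <= (rho * e) ^+ m.
  apply: le_trans (sum_coef_le_horner _ cge0 (ltW e0)) _.
  rewrite horner_exp; apply: lerXn2r; last exact: inner_small.
    rewrite nnegrE horner_coef sumr_ge0 // => k _.
    by rewrite mulr_ge0 ?exprn_ge0 ?(ltW e0) //; exact: pge0.
  by rewrite nnegrE mulr_ge0 ?(ltW e0) // /rho; move: r0; lra.
apply: le_trans (ler_wpM2l _ S) _; first by rewrite mulr_ge0 // ltW.
by rewrite exprMn le_eqVlt; apply/orP; left; apply/eqP; ring.
Qed.

End CompositionBound.
End WeightSequence.

(** * Linearity, and the bounds given by analyticity *)

Section LinearCombination.
Variables (R : realType) (X : set R[i]).
Hypothesis pX : perfect X.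

Lemma D_infty_lincomb (c : R[i]) f g h :
  (forall z, X z -> h z = f z + c * g z) -> D_infty X f -> D_infty X g ->
  D_infty X h /\ forall k z, X z -> cderivn X k h z = cderivn X k f z + c * cderivn X k g z.
Proof.
move=> hE Df Dg.
apply: (tower_D_infty pX (G := fun k z => cderivn X k f z + c * cderivn X k g z)).
  by move=> z Xz; rewrite hE.
move=> k a Xa; apply: has_cderivD; first exact: D_infty_has_cderiv.
by apply: has_cderivZ; exact: D_infty_has_cderiv.
Qed.

Lemma D_inftyB f g : D_infty X f -> D_infty X g ->
  D_infty X (f \- g) /\ forall k z, X z ->
    cderivn X k (f \- g) z = cderivn X k f z - cderivn X k g z.
Proof.
move=> Df Dg; have [|D E] := @D_infty_lincomb (-1) f g (f \- g) _ Df Dg.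
  by move=> z _; rewrite mulN1r.
by split=> // k z Xz; rewrite E // mulN1r.
Qed.

Lemma D_norm_sub (M : nat -> R) f g K L : X !=set0 -> (forall n, 0 < M n) ->
  D_infty X f -> D_infty X g ->
  (D_norm X M f <= K%:E)%E -> (D_norm X M g <= L%:E)%E ->
  (D_norm X M (f \- g)%R <= (K + L)%:E)%E.
Proof.
move=> X0 M0 Df Dg /(D_norm_bounds X0 M0)[beta [Hf Sf]].
move=> /(D_norm_bounds X0 M0)[gam [Hg Sg]].
apply: (D_norm_le X0 M0) => N; exists (fun m => beta m + gam m) => [m z _ Xz|].
  rewrite (D_inftyB Df Dg).2 //; apply: le_trans (nrmD _ _) _; rewrite nrmN.
  by apply: lerD; [exact: Hf|exact: Hg].
under eq_bigr do rewrite mulrDl.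
by rewrite big_split /=; exact: lerD (Sf N) (Sg N).
Qed.

Lemma analytic_bounds phi : X !=set0 -> analytic X phi ->
  exists2 C : R, 1 <= C & forall k z, X z ->
    nrm (cderivn X k.+1 phi z) <= k.+1`!%:R * C ^+ k.+1.
Proof.
move=> X0 [_]; set s := ereal_sup _ => sy.
have f0 k : 0 < (k`!%:R : R) by rewrite ltr0n fact_gt0.
have t0 k : (0 <= supnorm X (cderivn X k phi) * (k`!%:R^-1)%:E)%E.
  by rewrite mule_ge0 ?supnorm_ge0 // lee_fin invr_ge0 ltW.
have s0 : (0 <= s)%E.
  have : ((supnorm X (cderivn X 1 phi) * (1`!%:R^-1)%:E) `^ (1%:R^-1) <= s)%E.
    by apply: ereal_sup_ubound; exists 1%N.
  by apply: le_trans; exact: poweR_ge0.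
have sfin : s \is a fin_num by rewrite ge0_fin_numE.
exists (Num.max 1 (fine s)); first by rewrite le_max lexx.
move=> k z Xz; set C := Num.max _ _.
have : ((supnorm X (cderivn X k.+1 phi) * (k.+1`!%:R^-1)%:E) `^ (k.+1%:R^-1) <= C%:E)%E.
  apply: (@le_trans _ _ s); first by apply: ereal_sup_ubound; exists k.+1.
  by rewrite -(fineK sfin) lee_fin le_max lexx orbT.
have : ((nrm (cderivn X k.+1 phi z) / k.+1`!%:R)%:E <=
    supnorm X (cderivn X k.+1 phi) * (k.+1`!%:R^-1)%:E)%E.
  rewrite EFinM; apply: lee_wpmul2r; first by rewrite lee_fin invr_ge0 ltW.
  exact: le_supnorm.
have := t0 k.+1; case: (supnorm X _ * _)%E => [t| |] //.
- rewrite lee_fin => tge0; rewrite lee_fin => H1.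
  rewrite poweR_EFin lee_fin => H2.
  rewrite mulrC -ler_pdivrMr //; apply: le_trans H1 _.
  have <- : (t `^ k.+1%:R^-1) ^+ k.+1 = t.
    by rewrite -powR_mulrn ?powR_ge0 // -powRrM mulVf ?powRr1 // pnatr_eq0.
  by apply: lerXn2r; rewrite // nnegrE ?powR_ge0 // /C le_max ler01.
- by move=> _ _; rewrite poweRyr ?leye_eq // invr_eq0 pnatr_eq0.
Qed.

End LinearCombination.

(** * Limits of bounded sequences of D on the circle *)

Section Montel.
Variables (R : realType) (M : nat -> R).
Hypothesis M0 : forall n, 0 < M n.
Local Notation Gamma := (unit_circle R).
Let pG := @perfect_circle R.

Lemma circle_neq0 : Gamma !=set0.
Proof. by exists 1; apply/unit_circleE; exact: nrm1. Qed.

Lemma ultra_limit_circle (U : set_system nat) (zs : nat -> R[i]) :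
  UltraFilter U -> (forall n, Gamma (zs n)) ->
  exists v, Gamma v /\ forall e, 0 < e -> U [set n | nrm (zs n - v) < e].
Proof.
move=> UU Gzs; have zs1 n : nrm (zs n) = 1 by apply/unit_circleE; exact: Gzs.
have [|v Hv] := @ultra_limit R U zs 1 UU; first by move=> n; rewrite zs1.
exists v; split=> //.
apply/unit_circleE/le_anti/andP; split; apply/ler_addgt0Pr => d d0;
  have [n /= Hn] := filter_ex (Hv _ d0); rewrite -?(zs1 n).
  rewrite -(subKr (zs n) v); apply: le_trans (nrmD _ _) _.
  by rewrite nrmN zs1 lerD2l ltW.
rewrite -(subrK v (zs n)); apply: le_trans (nrmD _ _) _.
by rewrite addrC lerD2l ltW.
Qed.

Section Sequence.
Variables (F : nat -> R[i] -> R[i]) (B : R).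
Hypothesis DF : forall n, D_infty Gamma (F n).
Hypothesis NF : forall n, (D_norm Gamma M (F n) <= B%:E)%E.
Variable U : set_system nat.
Hypothesis UU : UltraFilter U.

Let b m := B * M m.

Let F_bound m n z : Gamma z -> nrm (cderivn Gamma m (F n) z) <= b m.
Proof.
move=> Gz; have [beta [Hb S]] := D_norm_bounds circle_neq0 M0 (NF n).
apply: le_trans (Hb m z Gz) _; rewrite /b -ler_pdivrMr //; apply: le_trans (S m.+1).
rewrite big_ord_recr /= lerDr sumr_ge0 // => k _.
by rewrite divr_ge0 ?(ltW (M0 k)) // (le_trans (nrm_ge0 _) (Hb k z Gz)).
Qed.

Let b_ge0 m : 0 <= b m.
Proof. by case: circle_neq0 => z Gz; apply: le_trans (nrm_ge0 _) (F_bound m 0 Gz). Qed.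

(** The bound B on the norms bounds the m-th derivatives by B M_m at each point. *)
Lemma circle_montel_pointwise : exists p : nat -> R[i] -> R[i],
  forall m z, Gamma z -> forall e, 0 < e ->
    U [set n | nrm (cderivn Gamma m (F n) z - p m z) < e].
Proof.
have /choice[p Hp] : forall mz : nat * R[i], exists l, Gamma mz.2 -> forall e, 0 < e ->
    U [set n | nrm (cderivn Gamma mz.1 (F n) mz.2 - l) < e].
  move=> [m z]; have [Gz|nGz] := pselect (Gamma z); last by exists 0.
  by have [l Hl] := ultra_limit UU (fun n => F_bound m n Gz); exists l.
by exists (fun m z => p (m, z)) => m z; exact: (Hp (m, z)).
Qed.

Section Limit.
Variable p : nat -> R[i] -> R[i].
Hypothesis Hp : forall m z, Gamma z -> forall e, 0 < e ->
    U [set n | nrm (cderivn Gamma m (F n) z - p m z) < e].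

Let p_bound m z : Gamma z -> nrm (p m z) <= b m.
Proof.
move=> Gz; apply/ler_addgt0Pr => e e0.
have [n /= Hn] := filter_ex (Hp m Gz e0).
rewrite -(subKr (cderivn Gamma m (F n) z) (p m z)).
apply: le_trans (nrmD _ _) _; rewrite nrmN; apply: lerD; [exact: F_bound|exact: ltW].
Qed.

(* Taylor's inequality is closed under pointwise limits, while differentiability
   is not: this is how the limits inherit derivatives. *)
Let p_taylor m w z : Gamma w -> Gamma z -> nrm (z - w) <= 2^-1 ->
  nrm (p m z - p m w - p m.+1 w * (z - w)) <= 8 * b m.+2 * nrm (z - w) ^+ 2.
Proof.
move=> Gw Gz zw; apply/ler_addgt0Pr => e e0; have e3 : 0 < e / 3 by rewrite divr_gt0.
have [n /= [[H1 H2] H3]] := filter_ex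
  (filterI (filterI (Hp m Gz e3) (Hp m Gw e3)) (Hp m.+1 Gw e3)).
have HF k v : Gamma v -> has_cderiv Gamma (cderivn Gamma k (F n)) v (cderivn Gamma k.+1 (F n) v).
  exact: D_infty_has_cderiv.
have T : nrm (cderivn Gamma m (F n) z - cderivn Gamma m (F n) w -
    cderivn Gamma m.+1 (F n) w * (z - w)) <= 8 * b m.+2 * nrm (z - w) ^+ 2.
  apply: (circle_taylor (f'' := cderivn Gamma m.+2 (F n))) => // v Gv; first exact: HF.
  by split; [exact: HF|exact: F_bound].
move: H1 H2 H3 T.
set a1 := cderivn _ _ _ z; set a2 := cderivn _ _ _ w; set a3 := cderivn _ _ _ w.
move=> H1 H2 H3 T.
rewrite (_ : _ - _ - _ = (a1 - a2 - a3 * (z - w)) + (- (a1 - p m z) + ((a2 - p m w)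
  + (a3 - p m.+1 w) * (z - w)))); last by ring.
apply: le_trans (nrmD _ _) _; apply: lerD => //.
apply: le_trans (nrmD _ _) _; rewrite nrmN.
apply: le_trans (lerD (lexx _) (nrmD _ _)) _; rewrite nrmM.
have : nrm (a3 - p m.+1 w) * nrm (z - w) <= e / 3 * 1.
  by apply: ler_pM; rewrite ?nrm_ge0 // ?(ltW H3) //; lra.
by lra.
Qed.

Let p_cderiv m w : Gamma w -> has_cderiv Gamma (p m) w (p m.+1 w).
Proof.
move=> Gw e e0; have K0 : 0 < 8 * b m.+2 + 1 by have := b_ge0 m.+2; lra.
exists (Num.min 2^-1 (e / (8 * b m.+2 + 1))) => [|z Gz].
  by rewrite lt_min invr_gt0 ltr0n divr_gt0.
rewrite lt_min => /andP[z1 z2]; apply: le_trans (p_taylor m Gw Gz (ltW z1)) _.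
rewrite expr2 mulrA; apply: ler_wpM2r; first exact: nrm_ge0.
move: z2; rewrite ltr_pdivlMr // => z2; have := nrm_ge0 (z - w); lra.
Qed.

Let p_tower : D_infty Gamma (p 0%N) /\
  forall k z, Gamma z -> cderivn Gamma k (p 0%N) z = p k z.
Proof. by apply: (tower_D_infty pG) => // k a Ga; exact: p_cderiv. Qed.

(* Equicontinuity and compactness of the circle: otherwise the points where
   uniformity fails have a limit v along U, and convergence fails at v. *)
Let uniform m e : 0 < e -> U [set n | forall z, Gamma z ->
  nrm (cderivn Gamma m (F n) z - p m z) <= e].
Proof.
move=> e0; set S := [set n | _].
have [//|nS] := in_ultra_setVsetC S UU.
have /choice[zs Hzs] : forall n, exists z, Gamma z /\
    (~ S n -> e < nrm (cderivn Gamma m (F n) z - p m z)).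
  move=> n; have [Sn|] := pselect (S n).
    by case: circle_neq0 => z Gz; exists z.
  move/existsNP => [z /not_implyP[Gz /negP]]; rewrite -ltNge => Hz.
  by exists z.
have [v [Gv Hv]] := ultra_limit_circle UU (fun n => (Hzs n).1).
have b0 := b_ge0 m.+1; have b1 : 0 < b m.+1 + 1 by lra.
have d0 : 0 < Num.min 1 (e / (6 * (b m.+1 + 1))).
  by rewrite lt_min ltr01 divr_gt0 // mulr_gt0.
have e3 : 0 < e / 3 by rewrite divr_gt0.
have [n /= [[nSn]]] := filter_ex (filterI (filterI nS (Hv _ d0)) (Hp m Gv e3)).
rewrite lt_min => /andP[v1 v2] H3.
have [Gzn /(_ nSn)] := Hzs n.
suff: nrm (cderivn Gamma m (F n) (zs n) - p m (zs n)) <= e.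
  by move=> /le_lt_trans H /H; rewrite ltxx.
have HF : nrm (cderivn Gamma m (F n) (zs n) - cderivn Gamma m (F n) v) <=
    2 * b m.+1 * nrm (zs n - v).
  apply: (circle_lipschitz (f' := cderivn Gamma m.+1 (F n))) => //; last exact: ltW.
  by move=> w Gw; split; [exact: D_infty_has_cderiv|exact: F_bound].
have HP : nrm (p m (zs n) - p m v) <= 2 * b m.+1 * nrm (zs n - v).
  apply: (circle_lipschitz (f' := p m.+1)) => //; last exact: ltW.
  by move=> w Gw; split; [exact: p_cderiv|exact: p_bound].
have L : 2 * b m.+1 * nrm (zs n - v) <= e / 3.
  move: v2; rewrite ltr_pdivlMr ?mulr_gt0 // => v2.
  by have := nrm_ge0 (zs n - v); nra.
move: H3 HF HP L; set a1 := cderivn _ _ _ v; set a2 := cderivn _ _ _ (zs n).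
move=> H3 HF HP L.
rewrite (_ : a2 - p m (zs n) = (a2 - a1) + ((a1 - p m v) - (p m (zs n) - p m v))); last by ring.
apply: le_trans (nrmD _ _) _; apply: le_trans (lerD (lexx _) (nrmD _ _)) _.
by rewrite nrmN; lra.
Qed.

(* Approximating the first N derivatives uniformly to within d costs at most 1 in
   the N-th partial sum of the norm. *)
Let p_norm : (D_norm Gamma M (p 0%N) <= (B + 1)%:E)%E.
Proof.
apply: (D_norm_le circle_neq0 M0) => N.
have S0 : 0 <= \sum_(m < N) (M m)^-1 by apply: sumr_ge0 => m _; rewrite invr_ge0 ltW.
pose d := (1 + \sum_(m < N) (M m)^-1)^-1.
have d0 : 0 < d by rewrite invr_gt0 ltr_wpDr.
have [n Hn] : exists n, forall m, (m < N)%N -> forall z, Gamma z ->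
    nrm (cderivn Gamma m (F n) z - p m z) <= d.
  apply: (@filter_ex _ U).
  elim: N {S0} d d0 => [|N IH] d d0; first by apply: filterS filterT => n _ m; rewrite ltn0.
  apply: filterS (filterI (IH _ d0) (uniform N d0)) => n /= [H1 H2] m.
  by rewrite ltnS leq_eqVlt => /orP[/eqP->//|/H1].
have [beta [Hb S]] := D_norm_bounds circle_neq0 M0 (NF n).
exists (fun m => beta m + d) => [m z mN Gz|].
  rewrite p_tower.2 // -(subKr (cderivn Gamma m (F n) z) (p m z)).
  by apply: le_trans (nrmD _ _) _; rewrite nrmN; apply: lerD; [exact: Hb|exact: Hn].
under eq_bigr do rewrite mulrDl.
rewrite big_split /= -mulr_sumr; apply: lerD (S N) _.
by rewrite /d ler_pdivrMl ?ltr_wpDr // mulr1 lerDr.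
Qed.

Lemma circle_montel_limit : [/\ D_infty Gamma (p 0%N),
  (D_norm Gamma M (p 0%N) <= (B + 1)%:E)%E &
  forall m e, 0 < e -> U [set n | forall z, Gamma z ->
    nrm (cderivn Gamma m (F n) z - cderivn Gamma m (p 0%N) z) <= e]].
Proof.
split; [exact: p_tower.1|exact: p_norm|move=> m e e0].
apply: filterS (uniform m e0) => n /= Hn z Gz; rewrite p_tower.2 //.
exact: Hn.
Qed.

End Limit.

(** A substitute for the theorem of Arzela and Ascoli, for all derivatives at
    once. The convergence is not in the norm of D: the tails of the norms need
    not be uniformly small. *)
Lemma circle_montel : exists g, [/\ D_infty Gamma g,
  (D_norm Gamma M g <= (B + 1)%:E)%E &
  forall m e, 0 < e -> U [set n | forall z, Gamma z ->
    nrm (cderivn Gamma m (F n) z - cderivn Gamma m g z) <= e]].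
Proof.
by have [p Hp] := circle_montel_pointwise; exists (p 0%N); exact: circle_montel_limit.
Qed.

End Sequence.
End Montel.

(** * A small derivative is sufficient for compactness *)

Section Sufficiency.
Variables (R : realType) (M : nat -> R).
Hypotheses (hM : weight_sequence M) (hna : nonanalytic M).
Local Notation Gamma := (unit_circle R).
Let pG := @perfect_circle R.
Let M0 := weight_gt0 hM.
Let G0 := @circle_neq0 R.
Variable phi : R[i] -> R[i].
Hypotheses (sphi : self_map Gamma phi) (aphi : analytic Gamma phi)
  (lphi : (supnorm Gamma (cderiv Gamma phi) < 1)%E).

Let Gphi z : Gamma z -> Gamma (phi z).
Proof. by move=> Gz; apply: sphi; exists z. Qed.

Let Dphi : D_infty Gamma phi. Proof. by case: aphi. Qed.

Let bound : exists A rho : R,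
  [/\ 0 <= A, 0 <= rho, rho < 1 & geometric_comp_bound M Gamma phi A rho].
Proof.
have [C C1 HC] := analytic_bounds G0 aphi.
have sfin : supnorm Gamma (cderiv Gamma phi) \is a fin_num.
  by rewrite ge0_fin_numE ?supnorm_ge0 // (lt_trans lphi) // ltry.
apply: (@composition_bound R M hM hna Gamma phi (fine (supnorm Gamma (cderiv Gamma phi))) C) => //.
- by rewrite fine_ge0 // supnorm_ge0.
- by rewrite -lte_fin fineK.
- by move=> z Gz; rewrite -lee_fin fineK //; exact: le_supnorm.
Qed.

Lemma induces_endomorphism_sufficient : induces_endomorphism Gamma M phi.
Proof.
move=> f /(dales_davieP G0 M0 f)[Df [K HK]].
apply/(dales_davieP G0 M0 _); split; first exact: D_infty_comp.
have [A [rho [A0 rho0 rho1 H]]] := bound.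
have [beta [Hb S]] := D_norm_bounds G0 M0 HK.
exists (A * K); apply: (D_norm_le G0 M0) => N.
have [beta' Hb' S'] := H f beta Df Hb N; exists beta' => //.
apply: le_trans S' _; apply: le_trans (ler_wpM2l A0 (S N)).
rewrite mulr_sumr; apply: ler_sum => m _; apply: ler_wpM2r.
  case: G0 => z Gz; rewrite divr_ge0 ?(ltW (M0 m)) //.
  by apply: le_trans (Hb m z Gz); exact: nrm_ge0.
by rewrite -[leRHS]mulr1 ler_wpM2l // exprn_ile1 // ltW.
Qed.

(** Let g be a limit of the sequence F, as in [circle_montel], and h = F_n - g. In
    the norm of h o phi the derivatives of h of order at least N0 enter with a
    factor at most A rho^N0, hence contribute little, uniformly in n; the finitely
    many others tend uniformly to 0. *)
Lemma compact_sufficient : compact_operator Gamma M (fun f => f \o phi).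
Proof.
move=> F B DF NF.
have [U [UU ooU]] := @ultraFilterLemma nat \oo _.
have DF' n : D_infty Gamma (F n) by case: (DF n).
have [g [Dg Ng Hg]] := circle_montel M0 DF' NF UU.
have [A [rho [A0 rho0 rho1 H]]] := bound.
pose K := B + (B + 1).
have small e : 0 < e -> U [set n | (D_norm Gamma M ((F n \o phi) \- (g \o phi))%R <= e%:E)%E].
  move=> e0.
  have Dh n := (D_inftyB pG (DF' n) Dg).1.
  have Eh n := (D_inftyB pG (DF' n) Dg).2.
  have /choice[gamma Hgamma] : forall n, exists gamma : nat -> R,
     (forall m z, Gamma z -> nrm (cderivn Gamma m (F n \- g) z) <= gamma m) /\
     (forall N, \sum_(m < N) gamma m / M m <= K).
    move=> n; apply: (D_norm_bounds G0 M0).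
    exact: (D_norm_sub pG G0 M0 (DF' n) Dg (NF n) Ng).
  have K0 : 0 <= K by have := (Hgamma 0%N).2 0%N; rewrite big_ord0.
  have [N0 HN0] : exists N0, A * rho ^+ N0 * K <= e / 2.
    have AK : 0 < A * K + 1 by rewrite ltr_wpDl // mulr_ge0.
    have eAK : 0 < e / (2 * (A * K + 1)) by rewrite divr_gt0 // mulr_gt0.
    have /cvgrPdist_lt/(_ _ eAK)[N0 _ /(_ N0 (leqnn _))] : rho ^+ n @[n --> \oo] --> (0 : R).
      by apply: cvg_expr; rewrite ger0_norm.
    rewrite sub0r normrN ger0_norm ?exprn_ge0 // ltr_pdivlMr ?mulr_gt0 // => HN.
    exists N0; have := exprn_ge0 N0 rho0; move: HN; move: (rho ^+ N0) => t; nra.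
  pose S0 := \sum_(m < N0) A / M m.
  have S00 : 0 <= S0 by apply: sumr_ge0 => m _; rewrite divr_ge0 // ltW.
  pose d := e / (2 * (S0 + 1)).
  have S1 : 0 < S0 + 1 by rewrite ltr_wpDl.
  have d0 : 0 < d by rewrite divr_gt0 // mulr_gt0.
  have dS : d * S0 <= e / 2.
    have <- : d * (S0 + 1) = e / 2 by rewrite /d; field; rewrite gt_eqF.
    by rewrite ler_wpM2l ?(ltW d0) // lerDl.
  have : U [set n | forall m, (m < N0)%N -> forall z, Gamma z ->
      nrm (cderivn Gamma m (F n) z - cderivn Gamma m g z) <= d].
    elim: (N0) => [|N IH]; first by apply: filterS filterT => n _ m; rewrite ltn0.
    apply: filterS (filterI IH (Hg N d d0)) => n /= [H1 H2] m.
    by rewrite ltnS leq_eqVlt => /orP[/eqP->//|/H1].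
  apply: filterS => n /= Hn.
  have [Hgn Sgn] := Hgamma n.
  apply: (D_norm_le G0 M0) => N.
  (* uniform convergence for the low orders, mere boundedness for the others *)
  pose beta m := if (m < N0)%N then d else gamma n m.
  have Hbeta m z : Gamma z -> nrm (cderivn Gamma m (F n \- g) z) <= beta m.
    move=> Gz; rewrite /beta; case: ifP => mN0; last exact: Hgn.
    by rewrite Eh //; exact: Hn.
  have [beta' Hb' S'] := H (F n \- g) beta (Dh n) Hbeta N; exists beta' => //.
  apply: le_trans S' _.
  have gM0 m : 0 <= gamma n m / M m.
    case: G0 => z Gz; rewrite divr_ge0 ?(ltW (M0 m)) //.
    by apply: le_trans (Hgn m z Gz); exact: nrm_ge0.
  have AM0 m : 0 <= A / M m * d by rewrite mulr_ge0 ?(ltW d0) // divr_ge0 // ltW.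
  apply: (@le_trans _ _ (\sum_(m < N) ((if (m < N0)%N then A / M m * d else 0)
      + A * rho ^+ N0 * (gamma n m / M m)))).
    apply: ler_sum => m _; rewrite /beta; case: ltnP => mN0.
      apply: ler_wpDr; first exact: (mulr_ge0 (mulr_ge0 A0 (exprn_ge0 _ rho0)) (gM0 m)).
      rewrite [leLHS](_ : _ = A / M m * d * rho ^+ m); last by ring.
      by rewrite ler_piMr // exprn_ile1 // ltW.
    rewrite add0r; apply: ler_wpM2r => //; apply: ler_wpM2l => //.
    by apply: ler_wiXn2l => //; exact: ltW.
  rewrite big_split /= -mulr_sumr [e]splitr; apply: lerD; last first.
    apply: le_trans HN0; apply: ler_wpM2l; last exact: Sgn.
    by rewrite mulr_ge0 // exprn_ge0.
  apply: le_trans dS; rewrite mulrC /S0 mulr_suml.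
  rewrite (big_ord_widen _ (fun m => A / M m * d) (leq_maxl N0 N)) [leRHS]big_mkcond /=.
  rewrite (big_ord_widen _ (fun m => if (m < N0)%N then A / M m * d else 0) (leq_maxr N0 N)).
  rewrite [leLHS]big_mkcond /=; apply: ler_sum => m _; case: ifP => _ //.
  by case: ifP.
have [|s [hs Hs]] := @ultra_subsequence U
    (fun k => [set n | (D_norm Gamma M ((F n \o phi) \- (g \o phi))%R <=
      (k.+1%:R^-1)%:E)%E]) UU ooU.
  by move=> k; apply: small; rewrite invr_gt0.
exists s; split=> //; exists (g \o phi).
  apply: induces_endomorphism_sufficient; apply/(dales_davieP G0 M0 g).
  by split; [exact: Dg|exists (B + 1)].
apply: (@squeeze_cvge _ _ _ _ (cst 0%E) _ (fun k => (k.+1%:R^-1)%:E)); last 2 first.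
- exact: cvg_cst.
- apply: cvg_EFin; first by near=> k.
  exact: cvg_harmonic.
by near=> k; rewrite D_norm_ge0 //=; exact: Hs.
Unshelve. all: by end_near. Qed.

End Sufficiency.

(** * Monomials and rotations *)

Section Monomials.
Variables (R : realType) (X : set R[i]).
Hypothesis pX : perfect X.

Lemma has_cderivX f a l n : has_cderiv X f a l ->
  has_cderiv X (fun z => f z ^+ n) a (n%:R * f a ^+ n.-1 * l).
Proof.
move=> H; elim: n => [|n IH].
  by rewrite !mul0r; exact: has_cderiv_cst.
have := has_cderivM H IH.
rewrite (_ : (fun z => f z * f z ^+ n) = (fun z => f z ^+ n.+1)); last first.
  by apply/funext => z; rewrite exprS.
congr (has_cderiv _ _ _ _); rewrite /= [n.+1%:R]mulrSr.
by case: n {IH} => [|n] /=; rewrite ?expr0 ?exprS; ring.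
Qed.

Lemma D_infty_monomial c n : D_infty X (fun z => (z - c) ^+ n) /\
  forall k z, X z -> cderivn X k (fun z => (z - c) ^+ n) z =
    (n ^_ k)%:R * (z - c) ^+ (n - k).
Proof.
apply: (tower_D_infty pX (G := fun k z => (n ^_ k)%:R * (z - c) ^+ (n - k))).
  by move=> z _; rewrite ffactn0 mul1r subn0.
move=> k a Xa.
have H : has_cderiv X (fun z => z - c) a 1.
  rewrite -[1]addr0; apply: has_cderivD; [exact: has_cderiv_id|exact: has_cderiv_cst].
apply: (has_cderiv_ext Xa _ _ (has_cderivZ _ (has_cderivX (n - k) H))) => //.
by rewrite ffactnSr natrM mulr1 subnS; ring.
Qed.

(** Rotations of the variable (u = 1, |c| = 1) and multiplication by scalars
    (c = 1) are treated together. *)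
Lemma D_infty_dilation (c u : R[i]) f : (forall z, X z -> X (c * z)) -> D_infty X f ->
  D_infty X (fun z => u * f (c * z)) /\
  forall k z, X z -> cderivn X k (fun z => u * f (c * z)) z =
    u * (c ^+ k * cderivn X k f (c * z)).
Proof.
move=> cX Df.
apply: (tower_D_infty pX (G := fun k z => u * (c ^+ k * cderivn X k f (c * z)))).
  by move=> z Xz; rewrite mul1r.
move=> k a Xa; apply: has_cderivZ.
have H := has_cderivZ c (has_cderiv_id X a).
have := has_cderivZ (c ^+ k) (has_cderiv_comp cX H (D_infty_has_cderiv pX k Df (cX _ Xa))).
by apply: has_cderiv_ext => //; rewrite exprSr; ring.
Qed.

End Monomials.

(** * Nearly extremal functions vanishing to a given order *)

Section Extremal.
Variables (R : realType) (M : nat -> R).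
Hypothesis M0 : forall n, 0 < M n.
Local Notation Gamma := (unit_circle R).
Let pG := @perfect_circle R.
Let G0 := @circle_neq0 R.

Lemma dales_davie_monomial c n : nrm c <= 1 ->
  dales_davie Gamma M (fun z => (z - c) ^+ n).
Proof.
move=> c1; have [D E] := D_infty_monomial pG c n.
apply/(dales_davieP G0 M0); split=> //.
pose beta k : R := (n ^_ k)%:R * 2 ^+ (n - k).
exists (\sum_(k < n.+1) beta k / M k); apply: (D_norm_le G0 M0) => N.
exists beta => [k z _ Gz|].
  rewrite E // nrmM nrm_nat nrmX; apply: ler_wpM2l => //.
  apply: lerXn2r; rewrite ?nnegrE ?nrm_ge0 //.
  apply: le_trans (nrmD _ _) _; rewrite nrmN.
  by have /unit_circleE -> := Gz; lra.
have b0 k : 0 <= beta k / M k by rewrite divr_ge0 ?mulr_ge0 ?exprn_ge0 // ltW.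
rewrite (big_ord_widen _ (fun k => beta k / M k) (leq_maxl N n.+1)) [leLHS]big_mkcond /=.
rewrite (big_ord_widen _ (fun k => beta k / M k) (leq_maxr N n.+1)) [leRHS]big_mkcond /=.
apply: ler_sum => k _; case: ifP => _; case: ltnP => // nk.
by rewrite /beta ffact_small // !mul0r.
Qed.

Lemma dilation_norm (c u : R[i]) f K : nrm c = 1 -> D_infty Gamma f ->
  (D_norm Gamma M f <= K%:E)%E ->
  [/\ D_infty Gamma (fun z => u * f (c * z)),
  (D_norm Gamma M (fun z => u * f (c * z))%R <= (nrm u * K)%:E)%E &
  forall k z, Gamma z -> cderivn Gamma k (fun z => u * f (c * z)) z =
    u * (c ^+ k * cderivn Gamma k f (c * z))].
Proof.
move=> c1 Df NK.
have cG z : Gamma z -> Gamma (c * z).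
  by move=> /unit_circleE z1; apply/unit_circleE; rewrite nrmM c1 z1 mulr1.
have [D E] := D_infty_dilation pG u cG Df; split=> //.
have [beta [Hb S]] := D_norm_bounds G0 M0 NK.
apply: (D_norm_le G0 M0) => N; exists (fun k => nrm u * beta k) => [k z _ Gz|].
  rewrite E // nrmM nrmM nrmX c1 expr1n mul1r; apply: ler_wpM2l; first exact: nrm_ge0.
  by apply: Hb; exact: cG.
under eq_bigr do rewrite -mulrA.
by rewrite -mulr_sumr; apply: ler_wpM2l; [exact: nrm_ge0|exact: S].
Qed.

(** The unit ball of the ideal V_n of functions that vanish at b with their
    derivatives of order less than n. *)
Definition vanishing_unit_ball n b : set (R[i] -> R[i]) :=
  [set f | [/\ D_infty Gamma f, (D_norm Gamma M f <= 1%:E)%E &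
    forall k, (k < n)%N -> cderivn Gamma k f b = 0]].

(** The functional f |-> f^(n)(b) on V_n is bounded by M_n, and nonzero because of
    (z - b)^n; a function that attains half of its norm stands in for the
    almost orthogonal vectors of Riesz' lemma. *)
Lemma near_extremal n b : Gamma b -> exists f, [/\ vanishing_unit_ball n b f,
  0 < nrm (cderivn Gamma n f b) &
  forall h, vanishing_unit_ball n b h ->
    nrm (cderivn Gamma n h b) <= 2 * nrm (cderivn Gamma n f b)].
Proof.
move=> Gb; pose E := [set nrm (cderivn Gamma n f b) | f in vanishing_unit_ball n b].
have b1 : nrm b = 1 by apply/unit_circleE.
have b1' : nrm b <= 1 by rewrite b1.
have /(dales_davieP G0 M0)[Dm [K NK]] := @dales_davie_monomial b n b1'.
have Em := (D_infty_monomial pG b n).2.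
pose L := Num.max 1 K; have L1 : 1 <= L by rewrite le_max lexx.
have L0 : 0 < L by exact: lt_le_trans L1.
have NL : (D_norm Gamma M (fun z => (z - b) ^+ n)%R <= L%:E)%E.
  by apply: le_trans NK _; rewrite lee_fin le_max lexx orbT.
have [D1 N1 E1] := dilation_norm (L^-1)%:C (@nrm1 R) Dm NL.
set m := (fun z => _) in D1 N1 E1.
have mV : vanishing_unit_ball n b m.
  split=> // [|k kn].
    by apply: le_trans N1 _; rewrite nrm_real ger0_norm ?invr_ge0 ?(ltW L0) // mulVf ?gt_eqF.
  by rewrite E1 // mul1r Em // subrr expr0n subn_eq0 leqNgt kn /= !mulr0.
have m0 : 0 < nrm (cderivn Gamma n m b).
  rewrite E1 // expr1n !mul1r Em // subnn mulr1 nrmM nrm_real nrm_nat ffactnn.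
  by rewrite mulr_gt0 ?ltr0n ?fact_gt0 // normr_gt0 invr_eq0 gt_eqF.
have Eub : ubound E (M n).
  move=> _ [f [Df Nf _] <-]; have [beta [Hb S]] := D_norm_bounds G0 M0 Nf.
  apply: le_trans (Hb n b Gb) _; rewrite -[M n]mul1r -ler_pdivrMr //.
  apply: le_trans (S n.+1); rewrite big_ord_recr /= lerDr sumr_ge0 // => k _.
  by rewrite divr_ge0 ?(ltW (M0 k)) // (le_trans (nrm_ge0 _) (Hb k b Gb)).
have hE : has_sup E by split; [exists (nrm (cderivn Gamma n m b)); exists m|exists (M n)].
have sE : 0 < sup E.
  by apply: lt_le_trans m0 _; apply: ub_le_sup; [exact: hE.2|exists m].
have s2 : 0 < sup E / 2 by rewrite divr_gt0.
have [_ [f fV <-] Hf] := sup_adherent s2 hE.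
exists f; split=> //; first by lra.
move=> h hV; apply: (@le_trans _ _ (sup E)); last by lra.
by apply: ub_le_sup; [exact: hE.2|exists h].
Qed.

(** Rotating a into b preserves the norm of D and the modulus of derivatives, so
    the norm of the functional does not depend on the base point. *)
Lemma extremal_transport n a b f h K : Gamma a -> Gamma b -> 0 < K ->
  (forall h, vanishing_unit_ball n b h ->
    nrm (cderivn Gamma n h b) <= 2 * nrm (cderivn Gamma n f b)) ->
  D_infty Gamma h -> (D_norm Gamma M h <= K%:E)%E ->
  (forall k, (k < n)%N -> cderivn Gamma k h a = 0) ->
  nrm (cderivn Gamma n h a) <= K * (2 * nrm (cderivn Gamma n f b)).
Proof.
move=> Ga Gb K0 Hf Dh NK h0.
have a1 : nrm a = 1 by apply/unit_circleE.
have b1 : nrm b = 1 by apply/unit_circleE.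
have bn0 : b != 0 by rewrite -nrm_gt0 b1.
have c1 : nrm (a / b) = 1 by rewrite nrmM nrmV a1 b1 divr1.
have [D1 N1 E1] := dilation_norm (K^-1)%:C c1 Dh NK.
set g := (fun z => _) in D1 N1 E1.
have gV : vanishing_unit_ball n b g.
  split=> // [|k kn].
    by apply: le_trans N1 _; rewrite nrm_real ger0_norm ?invr_ge0 ?(ltW K0) // mulVf ?gt_eqF.
  by rewrite E1 // divfK // h0 // !mulr0.
have := Hf g gV; rewrite E1 // divfK // !nrmM nrmX c1 expr1n mul1r nrm_real.
by rewrite gtr0_norm ?invr_gt0 // ler_pdivrMl.
Qed.

End Extremal.

(** * A small derivative is necessary for compactness *)

Section Necessity.
Variables (R : realType) (M : nat -> R).
Hypothesis M0 : forall n, 0 < M n.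
Local Notation Gamma := (unit_circle R).
Let pG := @perfect_circle R.
Let G0 := @circle_neq0 R.
Variable phi : R[i] -> R[i].
Hypothesis sphi : self_map Gamma phi.

Let Gphi z : Gamma z -> Gamma (phi z).
Proof. by move=> Gz; apply: sphi; exists z. Qed.

(** The identity function belongs to D, and phi is its image. *)
Lemma induces_endomorphism_D_infty : induces_endomorphism Gamma M phi -> D_infty Gamma phi.
Proof.
move=> H; have /H[] : dales_davie Gamma M (fun z => (z - 0) ^+ 1).
  by apply: dales_davie_monomial => //; rewrite nrm0.
rewrite (_ : _ \o phi = phi) //.
by apply/funext => z /=; rewrite subr0 expr1.
Qed.

(** The modulus of phi' is continuous on the circle, which is compact: a limit of
    points where it exceeds 1 - 1/(n+1) will do. *)
Lemma supnorm_ge1_attained : D_infty Gamma phi ->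
  (1 <= supnorm Gamma (cderiv Gamma phi))%E ->
  exists2 a, Gamma a & 1 <= nrm (cderiv Gamma phi a).
Proof.
have aux (t u v w r : R) : 1 - w < u -> t < r / 2 -> u <= t + v -> w < r / 2 -> 1 <= v + r.
  by lra.
move=> Dphi s1.
have /choice[zs Hzs] : forall n : nat, exists z, Gamma z /\
    1 - n.+1%:R^-1 < nrm (cderiv Gamma phi z).
  move=> n; apply: contrapT => /forallNP H.
  suff : (supnorm Gamma (cderiv Gamma phi) <= (1 - n.+1%:R^-1)%:E)%E.
    by move=> /(le_trans s1); rewrite lee_fin lerBrDr gerDl leNgt invr_gt0 ltr0n.
  by apply: supnorm_le => z Gz; rewrite leNgt; apply/negP => Hz; apply: (H z).
have [U [UU ooU]] := @ultraFilterLemma nat \oo _.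
have [a [Ga Ha]] := ultra_limit_circle UU (fun n => (Hzs n).1).
exists a => //; apply/ler_addgt0Pr => e e0.
have e2 : 0 < e / 2 by rewrite divr_gt0.
have := D_infty_has_cderiv pG 1 Dphi Ga.
rewrite -[cderivn Gamma 1 phi]/(cderiv Gamma phi) => /has_cderiv_lip[d d0 Hd].
set L := nrm _ + 1 in Hd; have L0 : 0 < L by rewrite ltr_wpDl ?nrm_ge0.
have d'0 : 0 < Num.min d (e / 2 / L) by rewrite lt_min d0 divr_gt0.
have Une : U [set n | n.+1%:R^-1 < e / 2].
  apply: ooU; have /cvgrPdist_lt/(_ _ e2) := @cvg_harmonic R.
  by apply: filterS => n /=; rewrite sub0r normrN ger0_norm.
have [n /= []] := filter_ex (filterI Une (Ha _ d'0)).
rewrite lt_min => ne /andP[nd]; rewrite ltr_pdivlMr // => nL.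
have [Gn Hn] := Hzs n; have := Hd _ Gn nd.
rewrite mulrC => /le_lt_trans/(_ nL) Hl.
have T : nrm (cderiv Gamma phi (zs n)) <=
    nrm (cderiv Gamma phi (zs n) - cderiv Gamma phi a) + nrm (cderiv Gamma phi a).
  by rewrite -{1}(subrK (cderiv Gamma phi a) (cderiv Gamma phi (zs n))) nrmD.
exact: aux Hn Hl T ne.
Qed.

(** Suppose that |phi'(a)| >= 1 and b = phi(a). For n < m, let f_n and f_m be nearly
    extremal for the orders n and m, and h the difference of their images. By
    [cderivn_comp_lead], h vanishes at a to order n, and
    h^(n)(a) = f_n^(n)(b) phi'(a)^n; extremality of f_n then forces the norm of
    h to be at least 1/2. So no subsequence of the images is Cauchy. *)
Lemma compact_necessary : induces_compact_endomorphism Gamma M phi ->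
  (supnorm Gamma (cderiv Gamma phi) < 1)%E.
Proof.
move=> [end_phi cpt]; rewrite ltNge; apply/negP => s1.
have Dphi := induces_endomorphism_D_infty end_phi.
have [a Ga a1] := supnorm_ge1_attained Dphi s1.
set b := phi a; have Gb : Gamma b by exact: Gphi.
have /choice[F HF] : forall n, exists f, [/\ vanishing_unit_ball M n b f,
  0 < nrm (cderivn Gamma n f b) &
  forall h, vanishing_unit_ball M n b h ->
    nrm (cderivn Gamma n h b) <= 2 * nrm (cderivn Gamma n f b)].
  by move=> n; exact: near_extremal.
have DF n : D_infty Gamma (F n) by have [[]] := HF n.
have NF n : (D_norm Gamma M (F n) <= 1%:E)%E by have [[]] := HF n.
have [|s [hs [g /(dales_davieP G0 M0)[Dg _] Hg]]] := cpt F 1 _ NF.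
  by move=> n; apply/(dales_davieP G0 M0); split; [exact: DF|exists 1; exact: NF].
have DFp n : D_infty Gamma (F n \o phi) by exact: (D_infty_comp pG Gphi (DF n) Dphi).
have [N HN] : exists N, forall k, (N <= k)%N ->
    (D_norm Gamma M ((F (s k) \o phi) \- g)%R <= (8^-1)%:E)%E.
  have /fine_cvgP[fin /cvgrPdist_le/(_ 8^-1)] := Hg.
  have e8 : (0 : R) < 8^-1 by rewrite invr_gt0.
  move=> /(_ e8) H; have [N _ HN] := filterI fin H; exists N => k /HN[/= kfin].
  by rewrite sub0r normrN => Hk; rewrite -(fineK kfin) lee_fin (le_trans (ler_norm _)).
set n := s N; set m := s N.+1.
have nm : (n < m)%N by exact: hs.
have [fV f0 Hf] := HF n.
pose h := (F n \o phi) \- (F m \o phi).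
have [Dh Eh] : D_infty Gamma h /\ forall k z, Gamma z -> cderivn Gamma k h z =
    cderivn Gamma k (F n \o phi) z - cderivn Gamma k (F m \o phi) z.
  exact: (D_inftyB pG (DFp n) (DFp m)).
have Nh : (D_norm Gamma M h <= (4^-1)%:E)%E.
  rewrite (_ : h = ((F n \o phi) \- g) \- ((F m \o phi) \- g)); last first.
    by apply/funext => z; rewrite /h /=; ring.
  rewrite (_ : 4^-1 = 8^-1 + 8^-1 :> R); last by field.
  apply: (D_norm_sub pG G0 M0 (D_inftyB pG (DFp n) Dg).1 (D_inftyB pG (DFp m) Dg).1 _ _).
    exact: (HN N (leqnn N)).
  exact: (HN N.+1 (leqnSn N)).
have van p k : (k < p)%N -> cderivn Gamma k (F p) b = 0.
  by move=> kp; have [[_ _ H] _ _] := HF p; exact: H.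
have Fp p k : (k <= p)%N -> cderivn Gamma k (F p \o phi) a =
    cderivn Gamma k (F p) b * cderiv Gamma phi a ^+ k.
  move=> kp; apply: (cderivn_comp_lead pG Gphi (DF p) Dphi Ga) => j jk.
  by apply: van; exact: leq_trans kp.
have h0 k : (k < n)%N -> cderivn Gamma k h a = 0.
  move=> kn; have km := ltn_trans kn nm.
  rewrite (Eh k a Ga) (Fp n k (ltnW kn)) (Fp m k (ltnW km)).
  by rewrite (van n k kn) (van m k km) mul0r subrr.
have hn : cderivn Gamma n h a = cderivn Gamma n (F n) b * cderiv Gamma phi a ^+ n.
  by rewrite (Eh n a Ga) (Fp n n (leqnn n)) (Fp m n (ltnW nm)) (van m n nm) mul0r subr0.
have q0 : (0 : R) < 4^-1 by rewrite invr_gt0.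
have := extremal_transport M0 Ga Gb q0 Hf Dh Nh h0.
rewrite hn nrmM nrmX.
have := exprn_ege1 n a1; move: (_ ^+ n) f0 => t; move: (nrm _) => v; nra.
Qed.

End Necessity.

Theorem theorem9 (R : realType) (M : nat -> R)
    (hM : weight_sequence M) (hna : nonanalytic M) :
  (forall phi : R[i] -> R[i],
      self_map (unit_circle R) phi ->
      analytic (unit_circle R) phi ->
      (supnorm (unit_circle R) (cderiv (unit_circle R) phi) < 1)%E ->
      induces_compact_endomorphism (unit_circle R) M phi) /\
  (forall phi : R[i] -> R[i],
      self_map (unit_circle R) phi ->
      induces_compact_endomorphism (unit_circle R) M phi ->
      (supnorm (unit_circle R) (cderiv (unit_circle R) phi) < 1)%E).
Proof.
split=> phi sphi; last exact: (compact_necessary (weight_gt0 hM)).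
move=> aphi lphi; split; first exact: induces_endomorphism_sufficient.
exact: compact_sufficient.
Qed.
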